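(* Let $\mathbb K$ be a field of characteristic $0$ and $x\in\mathbb K$. The Hopf subalgebra $\mathcal C_X$ of $\mathcal H_D$ spanned by disjoint unions (products) of corollas is isomorphic, as a Hopf algebra, to the Faà di Bruno Hopf algebra $\mathcal H_{FdB}$.
   Context: Dissection diagrams. For $n\ge 0$ let $\Pi_n$ be the regular $(n+1)$-gon with vertices $0,1,\dots,n$ numbered clockwise; vertex $0$ is the root. For $0\le i\le n$, side $i$ goes from vertex $i$ to vertex $i+1$ (with $n+1$ read as $0$). A chord is a segment joining two distinct vertices (adjacent vertices are allowed; such a chord is distinct from the side). A dissection diagram of degree $n$ is a set of $n$ pairwise non-crossing chords (they may share endpoints) of $\Pi_n$ forming an acyclic graph, hence a spanning tree on $\{0,\dots,n\}$. All chords are oriented towards the root. $\mathrm{Ch}(D)$ is the set of chords of $D$. The diagram of degree $0$ is identified with $1$. Coproduct. $\mathcal H_D$ is the commutative polynomial algebra on dissection diagrams of positive degree, with $\Delta(D)=\sum_{C\subset \mathrm{Ch}(D)}x^{k_C(D)}q_C(D)\otimes r_C(D)$ (with $x^0=1$), extended multiplicatively; it is a graded connected Hopf algebra. Here the $p=|C|$ chords of $C$ cut the polygon into $p+1$ faces; for a face $\alpha$ let $S_C(\alpha)$ be the (nonempty) set of sides of the polygon bordering $\alpha$. $q_C(D)$ is obtained by contracting every chord of $C$ to a point: each face $\alpha$ becomes a polygon with set of sides $S_C(\alpha)$, rooted at the starting vertex of its side of minimal label, carrying the chords of $D$ not in $C$ that lie in $\alpha$; this is a dissection diagram, and $q_C(D)$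 is the product of these over all faces. $r_C(D)$ is the dissection diagram of degree $p$ obtained by keeping the chords of $C$ and contracting all sides which are not the minimal side of their face, the root being the image of $0$. $k_C(D)$ is the number of chords of $C$ whose orientation in $D$ is opposite to their orientation (towards the root) in $r_C(D)$. Corollas. $X_0=1$, and for $n\ge1$ the corolla $X_n$ is the dissection diagram of degree $n$ with chords $i\to0$ for $1\le i\le n$. One has $\Delta(X_n)=\sum_{k=0}^n\Big(\sum_{i_0+\dots+i_k=n-k,\ i_j\ge0}X_{i_0}\cdots X_{i_k}\Big)\otimes X_k$, so $\mathcal C_X$ is a Hopf subalgebra. Faà di Bruno Hopf algebra. Let $G_1=\{h+\sum_{n\ge1}q_nh^{n+1}\in\mathbb K[[h]]\}$, a group under composition $\circ$ of series, and let $\Sigma_n:G_1\to\mathbb K$ be the coordinate map $h+\sum_m q_mh^{m+1}\mapsto q_n$. $\mathcal H_{FdB}=\mathbb K[\Sigma_1,\Sigma_2,\dots]$ with its usual product and the coproduct determined by $\Delta_{G_1}(f)(P\otimes Q)=f(Q\circ P)$ for $f\in\mathcal H_{FdB}$, $P,Q\in G_1$. *)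

(* Defs.v *)
(* MathComp, with the monoid algebras of multinomials (monalg). *)
From HB Require Import structures.
From mathcomp Require Import all_boot all_order all_algebra.
From mathcomp Require Export finmap.
From mathcomp.multinomials Require Export monalg.

Set Implicit Arguments.
Unset Strict Implicit.
Unset Printing Implicit Defensive.

Import GRing.Theory.
Local Open Scope ring_scope.

Section ProdMonom.
Variables M N : conomType.
Implicit Types u v w : (M * N)%type.

Definition prod_mone : M * N := (mone, mone).
Definition prod_mmul u v : M * N := (mmul u.1 v.1, mmul u.2 v.2).

Fact prod_mmulA : associative prod_mmul.
Proof. by move=> u v w; rewrite /prod_mmul !mulmA. Qed.

Fact prod_mul1m : left_id prod_mone prod_mmul.
Proof. by case=> a b; rewrite /prod_mmul !mul1m. Qed.

Fact prod_mulm1 : right_id prod_mone prod_mmul.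
Proof. by case=> a b; rewrite /prod_mmul !mulm1. Qed.

Fact prod_unitm u v :
  prod_mmul u v = prod_mone -> u = prod_mone /\ v = prod_mone.
Proof.
case: u v => [a b] [c d] [/= /unitm[-> ->] /unitm[-> ->]].
by split.
Qed.

Fact prod_mmulC : commutative prod_mmul.
Proof. by move=> u v; congr pair; apply: mulmC. Qed.

HB.instance Definition _ := Choice_isMonomialDef.Build (M * N)%type
  prod_mmulA prod_mul1m prod_mulm1 prod_unitm.
HB.instance Definition _ :=
  MonomialDef_isConomialDef.Build (M * N)%type prod_mmulC.
End ProdMonom.

(* The tensor product K[M] (x) K[N] is the algebra K[M * N], whose basis       *)
(* element << (m, n) >> is m (x) n.                                            *)
Section Tensor.
Variable K : fieldType.

Definition tens (M N : conomType) (p : {malg K[M]}) (q : {malg K[N]}) :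
    {malg K[(M * N)%type]} :=
  \sum_(m <- msupp p) \sum_(n <- msupp q) << p@_m * q@_n *g (m, n) >>.

(* f (x) g, for linear f and g. *)
Definition tens_map (M N M' N' : conomType) (f : {malg K[M]} -> {malg K[M']})
    (g : {malg K[N]} -> {malg K[N']}) (t : {malg K[(M * N)%type]}) :
    {malg K[(M' * N')%type]} :=
  \sum_(u <- msupp t) t@_u *: tens (f << u.1 >>) (g << u.2 >>).

Definition tens_assoc (M N L : conomType) (t : {malg K[((M * N) * L)%type]}) :
    {malg K[(M * (N * L))%type]} :=
  \sum_(u <- msupp t) << t@_u *g (u.1.1, (u.1.2, u.2)) >>.

Definition tens_mul (M : conomType) (t : {malg K[(M * M)%type]}) : {malg K[M]} :=
  \sum_(u <- msupp t) t@_u *: (<< u.1 >> * << u.2 >>).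

(* f (x) id : K[M] (x) K[N] -> K (x) K[N] = K[N], for a linear form f,         *)
(* and its mirror image.                                                       *)
Definition tens_forml (M N : conomType) (f : {malg K[M]} -> K)
    (t : {malg K[(M * N)%type]}) : {malg K[N]} :=
  \sum_(u <- msupp t) (t@_u * f << u.1 >>) *: << u.2 >>.

Definition tens_formr (M N : conomType) (f : {malg K[N]} -> K)
    (t : {malg K[(M * N)%type]}) : {malg K[M]} :=
  \sum_(u <- msupp t) (t@_u * f << u.2 >>) *: << u.1 >>.
End Tensor.

Notation "p \ox q" := (tens p q)
  (at level 40, left associativity) : ring_scope.

Section Hopf.
Variables (K : fieldType) (M : conomType).
Let A := {malg K[M]}.
Let AA := {malg K[(M * M)%type]}.

(* C is a subalgebra of A = K[M], mapped by Delta into C (x) C, and the        *)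
(* restrictions of Delta, eps and S make it a Hopf algebra.  The antipode of C *)
(* is given by a linear map S on A: as Delta p is in C (x) C for p in C, the   *)
(* antipode axioms only depend on the restriction of S to C.                   *)
Record hopf_subalgebra (C : A -> Prop) (Delta : A -> AA) (eps : A -> K)
    (S : A -> A) : Prop := HopfSubalgebra {
  hopf_lin : forall a p q, C p -> C q -> C (a *: p + q);
  hopf_one : C 1;
  hopf_mul : forall p q, C p -> C q -> C (p * q);
  hopf_comul_sub : forall p, C p -> exists s : seq (A * A),
    (forall u, u \in s -> C u.1 /\ C u.2) /\
    Delta p = \sum_(u <- s) u.1 \ox u.2;
  hopf_anti_sub : forall p, C p -> C (S p);
  hopf_comul_linear : forall a p q, Delta (a *: p + q) = a *: Delta p + Delta q;
  hopf_comul_one : Delta 1 = 1;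
  hopf_comul_mul : forall p q, Delta (p * q) = Delta p * Delta q;
  hopf_counit_linear : forall a p q, eps (a *: p + q) = a * eps p + eps q;
  hopf_counit_one : eps 1 = 1;
  hopf_counit_mul : forall p q, eps (p * q) = eps p * eps q;
  hopf_anti_linear : forall a p q, S (a *: p + q) = a *: S p + S q;
  hopf_coassoc : forall p, C p ->
    tens_assoc (tens_map Delta id (Delta p)) = tens_map id Delta (Delta p);
  hopf_counitl : forall p, C p -> tens_forml eps (Delta p) = p;
  hopf_counitr : forall p, C p -> tens_formr eps (Delta p) = p;
  hopf_antil : forall p, C p ->
    tens_mul (tens_map S id (Delta p)) = eps p *: 1;
  hopf_antir : forall p, C p ->
    tens_mul (tens_map id S (Delta p)) = eps p *: 1
}.
End Hopf.

Definition full (T : Type) (_ : T) : Prop := True.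

(* phi is an isomorphism from the Hopf algebra K[N] onto the Hopf subalgebra C *)
(* of K[M].                                                                    *)
Record hopf_iso (K : fieldType) (N M : conomType)
    (DeltaN : {malg K[N]} -> {malg K[(N * N)%type]}) (epsN : {malg K[N]} -> K)
    (SN : {malg K[N]} -> {malg K[N]})
    (C : {malg K[M]} -> Prop)
    (DeltaM : {malg K[M]} -> {malg K[(M * M)%type]}) (epsM : {malg K[M]} -> K)
    (SM : {malg K[M]} -> {malg K[M]})
    (phi : {malg K[N]} -> {malg K[M]}) : Prop := HopfIso {
  iso_linear : forall a p q, phi (a *: p + q) = a *: phi p + phi q;
  iso_one : phi 1 = 1;
  iso_mul : forall p q, phi (p * q) = phi p * phi q;
  iso_inj : injective phi;
  iso_image : forall p, C p <-> exists q, p = phi q;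
  iso_comul : forall q, DeltaM (phi q) = tens_map phi phi (DeltaN q);
  iso_counit : forall q, epsM (phi q) = epsN q;
  iso_anti : forall q, SM (phi q) = phi (SN q)
}.

(* For a graded connected algebra K[M], with unit monomial in degree 0, this   *)
(* is the projection on degree 0.                                              *)
Definition counit (K : fieldType) (M : conomType) (p : {malg K[M]}) : K :=
  p@_mone.

Section PolynomialAlgebra.
Variables (K : fieldType) (I : choiceType).

Definition mon_eval (S : comPzRingType) (v : I -> S) (m : {cmonom I}) : S :=
  \prod_(i <- finsupp m) v i ^+ m i.

Definition poly_eval (v : I -> K) (p : {malg K[{cmonom I}]}) : K :=
  \sum_(m <- msupp p) p@_m * mon_eval v m.

(* The algebra morphism sending each generator i to v i. *)
Definition poly_ext (N : conomType) (v : I -> {malg K[N]})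
    (p : {malg K[{cmonom I}]}) : {malg K[N]} :=
  \sum_(m <- msupp p) p@_m *: mon_eval v m.
End PolynomialAlgebra.

Section Chords.
Variable n : nat.

(* The chord {a, b}, with a < b, is the pair (a, b).  Both vertices and sides  *)
(* are indexed by 'I_n.+1.                                                     *)
Definition chord : Type := ('I_n.+1 * 'I_n.+1)%type.
HB.instance Definition _ := Finite.on chord.

Implicit Types (c d : chord) (C D : {set chord}) (S : {set 'I_n.+1}).

Definition mkchord (u v : 'I_n.+1) : chord :=
  if (u < v)%N then (u, v) else (v, u).

Definition crossing c d : bool := [&& c.1 < d.1, d.1 < c.2 & c.2 < d.2]%N.

Definition adjacent D : rel 'I_n.+1 :=
  fun u v => ((u, v) \in D) || ((v, u) \in D).

Definition acyclic D : bool :=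
  [forall k : 'I_n.+2, forall t : k.-tuple 'I_n.+1,
     ~~ [&& (2 < k)%N, uniq t & cycle (adjacent D) t]].

Definition dissection D : bool :=
  [&& #|D| == n, [forall c in D, (c.1 < c.2)%N],
      [forall c in D, forall d in D, ~~ crossing c d] & acyclic D].

(* The chord (a, b) cuts the polygon into two parts; the sides and the chords  *)
(* of the part not containing side n are those contained in [a, b].            *)
Definition side_below c (s : 'I_n.+1) : bool := (c.1 <= s < c.2)%N.
Definition chord_below c d : bool := ((c.1 <= d.1) && (d.2 <= c.2))%N.

(* Two sides border the same face iff no chord of C separates them; a face is  *)
(* represented by its (nonempty) set of sides.                                 *)
Definition same_face C : rel 'I_n.+1 :=
  fun s t => [forall c in C, side_below c s == side_below c t].

Definition faces C : {set {set 'I_n.+1}} :=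
  equivalence_partition (same_face C) [set: 'I_n.+1].

Definition lies_in C d S : bool :=
  [forall c in C, forall s in S, chord_below c d == side_below c s].

Definition minimal_sides C : {set 'I_n.+1} :=
  [set s | [forall t, same_face C s t ==> (s <= t)%N]].

(* The chord joining u and v is oriented from u to v: v is still joined to the *)
(* root once this chord is removed.                                            *)
Definition oriented D (u v : 'I_n.+1) : bool :=
  connect (adjacent (D :\ mkchord u v)) v ord0.
End Chords.

Section Contraction.
Variables (n : nat) (S : {set 'I_n.+1}).

(* The polygon whose sides are those in S, in increasing order, vertex j being *)
(* the starting vertex of the j-th one; everything else on the boundary (sides *)
(* not in S, chords) is contracted.  A vertex v thus becomes the starting      *)
(* vertex of the first side in S met clockwise from v.                         *)
Definition contract_vertex (v : 'I_n.+1) : 'I_(#|S|.-1).+1 :=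
  inord (#|[set s in S | (s < v)%N]| %% #|S|).

Definition contract_chord (c : chord n) : chord #|S|.-1 :=
  mkchord (contract_vertex c.1) (contract_vertex c.2).
End Contraction.

Definition face_diagram n (D C : {set chord n}) (S : {set 'I_n.+1}) :
    {set chord #|S|.-1} :=
  contract_chord S @: [set d in D :\: C | lies_in C d S].

Definition r_diagram n (C : {set chord n}) :
    {set chord #|minimal_sides C|.-1} :=
  contract_chord (minimal_sides C) @: C.

Definition k_number n (D C : {set chord n}) : nat :=
  let cv := contract_vertex (minimal_sides C) in
  #|[set c in C | oriented D c.1 c.2 !=
                    oriented (r_diagram C) (cv c.1) (cv c.2)]|.

Definition diagram n : Type := {D : {set chord n} | dissection D}.
HB.instance Definition _ n := SubFinite.on (diagram n).

(* The dissection diagrams of positive degree. *)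
Definition pos_diagram : Type := {n : nat & diagram n.+1}.
HB.instance Definition _ := Choice.on pos_diagram.

Notation HD K := {malg K[{cmonom pos_diagram}]}.
Notation HD2 K := {malg K[({cmonom pos_diagram} * {cmonom pos_diagram})%type]}.

Section ComulD.
Variables (K : fieldType) (x : K).

(* The class in HD of the dissection diagram with set of chords D.  The value  *)
(* 0 is junk: it is only returned if D is not a dissection diagram.            *)
Definition diag_elt (n : nat) : {set chord n} -> HD K :=
  match n with
  | 0 => fun _ => 1
  | n'.+1 => fun D =>
    if (insub D : option (diagram n'.+1)) is Some d
    then << ucm (existT _ n' d : pos_diagram) >> else 0
  end.

Definition q_elt n (D C : {set chord n}) : HD K :=
  \prod_(S in faces C) diag_elt (face_diagram D C S).

Definition r_elt n (C : {set chord n}) : HD K := diag_elt (r_diagram C).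

Definition comul_diagram n (D : {set chord n}) : HD2 K :=
  \sum_(C : {set chord n} | C \subset D)
     x ^+ k_number D C *: (q_elt D C \ox r_elt C).

Definition comulD : HD K -> HD2 K :=
  poly_ext (fun d : pos_diagram => comul_diagram (val (tagged d))).
End ComulD.

Definition corolla_chords n : {set chord n} :=
  [set c | (c.1 == ord0) && (c.2 != ord0)].

Definition corolla (K : fieldType) (n : nat) : HD K :=
  diag_elt K (corolla_chords n).

Definition CX (K : fieldType) (p : HD K) : Prop :=
  exists s : seq (K * seq nat),
    p = \sum_(u <- s) u.1 *: \prod_(n <- u.2) corolla K n.

(* The generator of index i is Sigma_(i+1). *)
Notation HFdB K := {malg K[{cmonom nat}]}.
Notation HFdB2 K := {malg K[({cmonom nat} * {cmonom nat})%type]}.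

(* A formal power series is given by its coefficients. *)
Section Series.
Variable K : fieldType.
Implicit Types A B P Q : nat -> K.

Definition series_mul A B : nat -> K :=
  fun n => \sum_(i < n.+1) A i * B (n - i)%N.

Definition series_one : nat -> K := fun n => (n == 0%N)%:R.

Definition series_pow A (k : nat) : nat -> K := iter k (series_mul A) series_one.

(* Q o P = \sum_k Q_k P^k: as P has no constant term, P^k does not contribute  *)
(* in degree n when k > n.                                                     *)
Definition series_comp Q P : nat -> K :=
  fun n => \sum_(k < n.+1) Q k * series_pow P k n.

Definition in_G1 P : Prop := P 0%N = 0 /\ P 1%N = 1.

Definition Sigma_coord P (i : nat) : K := P i.+2.

Definition fdb_eval P (f : HFdB K) : K := poly_eval (Sigma_coord P) f.

(* (f (x) g)(P (x) Q) = f(P) g(Q) *)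
Definition fdb_eval2 P Q (t : HFdB2 K) : K :=
  \sum_(u <- msupp t)
     t@_u * (mon_eval (Sigma_coord P) u.1 * mon_eval (Sigma_coord Q) u.2).

Definition fdb_comul (Delta : HFdB K -> HFdB2 K) : Prop :=
  forall f P Q, in_G1 P -> in_G1 Q ->
    fdb_eval2 P Q (Delta f) = fdb_eval (series_comp Q P) f.
End Series.

(* Main.v *)
Require Import Defs.
From mathcomp Require Import all_boot all_order all_algebra.
From mathcomp Require Import zify.

(** Write Sigma_0 = 1 and let U = sum_(i >= 0) Sigma_i h^(i+1) be the universal
    series of G_1.  The coefficient of h^(n+1) in Q o P is the sum over k of
    the coefficient Q_k times that of h^(n+1) in P^k, so the coproduct of the
    Faa di Bruno algebra is forced to be
      Delta(Sigma_n) = sum_k [h^(n+1)] U^(k+1) (x) Sigma_k.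
    Expanding the power gives the sum of the Sigma_(i_0) ... Sigma_(i_k) over
    i_0 + ... + i_k = n - k, which is the coproduct of the corolla X_n with
    Sigma in place of X.  Hence the algebra morphism Sigma_n |-> X_n is the
    isomorphism, once three things are known.

    The Faa di Bruno algebra is a Hopf algebra, and Delta is determined by its
    values on G_1 x G_1 ([fdb_hopf], [fdb_Delta_unique]).  Evaluation turns a
    monomial into a multiplicative character of the monoid of all families of
    coordinates, and in characteristic 0 distinct monomials give distinct
    characters.  By the independence of characters
    ([characters_independent]), an element of a tensor power of the algebra is
    known from its values on tuples of points of G_1.  Each Hopf axiom thereby
    becomes an axiom of the group G_1: associativity of composition
    ([series_compA]), the neutral series h, and the existence of an inverse
    whose coefficients are polynomials in those of the series ([linvE],
    [linv_compr]).

    The coproduct of a corolla is as announced ([comul_corolla]).  A set of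
    chords j -> 0 of the corolla cuts the sides of the polygon into
    consecutive intervals.  Each face carries a corolla, the contraction
    r_C is again a corolla, and all orientations are kept, so that x does not
    occur.  What remains is a sum, over the subsets of {1, ..., n}, of products
    indexed by the intervals that a subset cuts out; encoding subsets as words
    of bits, a recursion on the word identifies it with the coefficient of a
    power of a series ([sum_face_prod]).

    The corollas of positive degree are distinct generators of the polynomial
    algebra of diagrams.  So Sigma_n |-> X_n has a retraction
    ([to_corollasK]), hence is injective, and the Hopf structure is carried
    over to its image ([hopf_transport]). *)

Set Implicit Arguments.
Unset Strict Implicit.
Unset Printing Implicit Defensive.

Import GRing.Theory.
Local Open Scope ring_scope.

(** * Linear maps and algebra morphisms on monoid algebras *)

Section LinearExtension.
Variable K : fieldType.

Lemma malgZU (M : choiceType) (c : K) (m : M) :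
  << c *g m >> = c *: << m >> :> {malg K[M]}.
Proof.
by apply/malgP=> k; rewrite mcoeffZ !mcoeffU -mulr_natr -(mulr_natr 1) mul1r.
Qed.

Lemma malg_lin_ind (M : choiceType) (Pr : {malg K[M]} -> Prop) :
    Pr 0 -> (forall m, Pr << m >>) ->
    (forall a p q, Pr p -> Pr q -> Pr (a *: p + q)) ->
  forall p, Pr p.
Proof.
move=> P0 PU PL p; rewrite (monalgE p).
elim/big_rec: _ => // m q _ Pq.
by rewrite malgZU; apply: PL.
Qed.

Section Lext.
Variables (M : choiceType) (V : lmodType K) (h : M -> V).

(** The linear extension of a map given on the basis.  Most maps of interest
    (evaluations, tensor products of maps, the reassociation of tensors) are
    of this form, with values in K^o for linear forms. *)
Definition lext (p : {malg K[M]}) : V := \sum_(m <- msupp p) p@_m *: h m.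

Lemma lextEw (E : {fset M}) p : (msupp p `<=` E)%fset ->
  lext p = \sum_(m <- E) p@_m *: h m.
Proof.
move=> le; rewrite [LHS](big_fset_incl _ le) => //= x xd /mcoeff_outdom ->.
by rewrite scale0r.
Qed.

Lemma lext_linear : linear lext.
Proof.
move=> a p q; pose E := (msupp p `|` msupp q `|` msupp (a *: p + q))%fset.
have leP : (msupp p `<=` E)%fset by rewrite /E -fsetUA fsubsetUl.
have leQ : (msupp q `<=` E)%fset.
  by apply: fsubset_trans (fsubsetUr (msupp p) _) _; rewrite /E fsubsetUl.
have leS : (msupp (a *: p + q) `<=` E)%fset by rewrite /E fsubsetUr.
rewrite (lextEw leP) (lextEw leQ) (lextEw leS) scaler_sumr -big_split /=.
by apply: eq_bigr => m _; rewrite mcoeffD mcoeffZ scalerDl scalerA.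
Qed.

Lemma lextU m : lext << m >> = h m.
Proof. by rewrite (lextEw msuppU_le) big_seq_fset1 mcoeffUU scale1r. Qed.
End Lext.

(* Linearity and multiplicativity are kept as predicates on bare functions,
   because the Hopf axioms bear on bare functions. *)
Lemma linear_map0 (U V : lmodType K) (f : U -> V) : linear f -> f 0 = 0.
Proof.
by move=> fL; have := fL (-1) 0 0; rewrite scaler0 addr0 scaleN1r addNr.
Qed.

Lemma linear_mapZ (U V : lmodType K) (f : U -> V) a u :
  linear f -> f (a *: u) = a *: f u.
Proof. by move=> fL; rewrite -[a *: u]addr0 fL linear_map0 // addr0. Qed.

Lemma linear_mapB (U V : lmodType K) (f : U -> V) u v :
  linear f -> f (u - v) = f u - f v.
Proof. by move=> fL; rewrite addrC -scaleN1r fL scaleN1r addrC. Qed.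

Lemma linear_map_sum (U V : lmodType K) (f : U -> V) (I : Type) (s : seq I)
    (P : pred I) (F : I -> U) : linear f ->
  f (\sum_(i <- s | P i) F i) = \sum_(i <- s | P i) f (F i).
Proof.
move=> fL; apply: (big_morph f) => [u v|]; last exact: linear_map0.
by rewrite -[u]scale1r fL !scale1r.
Qed.

Lemma linear_ext (M : choiceType) (V : lmodType K) (f g : {malg K[M]} -> V) :
  linear f -> linear g -> (forall m, f << m >> = g << m >>) -> f =1 g.
Proof.
move=> fL gL fg; elim/malg_lin_ind => [||a p q IHp IHq] //.
  by rewrite !linear_map0.
by rewrite fL gL IHp IHq.
Qed.

Lemma malg1E (M : conomType) : 1 = << mone >> :> {malg K[M]}.
Proof. by []. Qed.

Lemma malgUM (M : conomType) (m n : M) :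
  << m >> * << n >> = << mmul m n >> :> {malg K[M]}.
Proof. by rewrite malgM_def fgmulUU mul1r. Qed.

Definition alg_morph (A B : comAlgType K) (f : A -> B) : Prop :=
  [/\ linear f, f 1 = 1 & forall p q, f (p * q) = f p * f q].

(** Multiplicativity on the basis suffices, by bilinearity on each side. *)
Lemma lext_mul (M : conomType) (A : comAlgType K) (h : M -> A) :
  (forall m n, h (mmul m n) = h m * h n) ->
  forall p q, lext h (p * q) = lext h p * lext h q.
Proof.
move=> hM; elim/malg_lin_ind => [q|m|a p p' IHp IHp' q].
- by rewrite mul0r linear_map0 ?mul0r //; apply: lext_linear.
- elim/malg_lin_ind => [|n|a q q' IHq IHq'].
  + by rewrite mulr0 linear_map0 ?mulr0 //; apply: lext_linear.
  + by rewrite malgUM !lextU hM.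
  + by rewrite mulrDr -scalerAr !lext_linear IHq IHq' mulrDr -scalerAr.
- by rewrite mulrDl -scalerAl !lext_linear IHp IHp' mulrDl -scalerAl.
Qed.

Lemma lext_morph (M : conomType) (A : comAlgType K) (h : M -> A) :
  h mone = 1 -> (forall m n, h (mmul m n) = h m * h n) -> alg_morph (lext h).
Proof.
move=> h1 hM; split; [exact: lext_linear| |exact: lext_mul].
by rewrite malg1E lextU.
Qed.

Section Characters.
Variables (I : choiceType) (S : comPzRingType) (v : I -> S).

Lemma mon_evalEw (E : {fset I}) (m : {cmonom I}) : (finsupp m `<=` E)%fset ->
  mon_eval v m = \prod_(i <- E) v i ^+ m i.
Proof.
move=> le; rewrite [LHS](big_fset_incl _ le) => //= i _.
by rewrite -cmE_eq0 => /eqP ->; rewrite expr0.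
Qed.

Lemma mon_eval1 : mon_eval v mone = 1.
Proof. by rewrite /mon_eval mdom1 big_seq_fset0. Qed.

Lemma mon_evalU i : mon_eval v (ucm i) = v i.
Proof. by rewrite /mon_eval mdomU big_seq_fset1 cmUU expr1. Qed.

Lemma mon_evalM m n : mon_eval v (mmul m n) = mon_eval v m * mon_eval v n.
Proof.
rewrite [LHS]/mon_eval mdomD.
rewrite (mon_evalEw (fsubsetUl _ (finsupp n))).
rewrite (mon_evalEw (fsubsetUr (finsupp m) _)) -big_split /=.
by apply: eq_bigr => i _; rewrite cmM exprD.
Qed.

End Characters.

Lemma mon_eval_vM (I : choiceType) (S : comPzRingType) (v w : I -> S) m :
  mon_eval (fun i => v i * w i) m = mon_eval v m * mon_eval w m.
Proof.
by rewrite /mon_eval -big_split; apply: eq_bigr => i _; rewrite exprMn.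
Qed.

Lemma poly_ext_morph (I : choiceType) (N : conomType) (v : I -> {malg K[N]}) :
  alg_morph (poly_ext v).
Proof. by apply: lext_morph; [apply: mon_eval1|apply: mon_evalM]. Qed.

Lemma poly_extU (I : choiceType) (N : conomType) (v : I -> {malg K[N]}) i :
  poly_ext v << ucm i >> = v i.
Proof. by rewrite /poly_ext -/(lext _ _) lextU mon_evalU. Qed.

(** Induction on the degree, splitting off one generator at a time. *)
Lemma cmonom_ind (I : choiceType) (Pr : {cmonom I} -> Prop) :
    Pr mone -> (forall i m, Pr m -> Pr (mmul (ucm i) m)) ->
  forall m, Pr m.
Proof.
move=> P1 PM m; have [d] := ubnP (mdeg m); elim: d m => // d IHd m md.
have [->//|m1] := eqVneq m mone.
have [i im] : exists i, i \in finsupp m.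
  apply/fset0Pn; apply: contraNneq m1 => m0.
  by rewrite -mdeg_eq0 mdegE m0 big_seq_fset0.
have mE : m = mmul (ucm i) (divcm m (ucm i)).
  apply/eqP/cmP => j; rewrite cmM cmU divcmE cmU.
  case: eqP => [<-|_]; last by rewrite subn0.
  by rewrite subnKC // lt0n cmE_neq0.
rewrite mE; apply/PM/IHd.
by move: md; rewrite {1}mE mdegM mdegU.
Qed.

Lemma alg_morph_ext (I : choiceType) (A : comAlgType K)
    (f g : {malg K[{cmonom I}]} -> A) :
  alg_morph f -> alg_morph g -> (forall i, f << ucm i >> = g << ucm i >>) ->
  f =1 g.
Proof.
move=> [fL f1 fM] [gL g1 gM] fg; apply: linear_ext => // m.
elim/cmonom_ind: m => [|i m IHm].
  by rewrite -(malg1E {cmonom I}) f1 g1.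
rewrite -(malgUM (ucm i) m) fM gM; congr (_ * _); first exact: fg.
exact: IHm.
Qed.
End LinearExtension.

(** * Tensor products and independence of characters *)

Section TensorTheory.
Variable K : fieldType.

Lemma tensE (M N : conomType) (p : {malg K[M]}) (q : {malg K[N]}) :
  p \ox q = lext (fun m => lext (fun n => << (m, n) >>) q) p.
Proof.
apply: eq_bigr => m _; rewrite /lext scaler_sumr; apply: eq_bigr => n _.
by rewrite malgZU scalerA.
Qed.

Lemma tens_linearl (M N : conomType) (q : {malg K[N]}) :
  linear (fun p : {malg K[M]} => p \ox q).
Proof. by move=> a p p'; rewrite !tensE lext_linear. Qed.

Lemma tens_linearr (M N : conomType) (p : {malg K[M]}) :
  linear (fun q : {malg K[N]} => p \ox q).
Proof.
move=> a q q'; rewrite !tensE /lext scaler_sumr -big_split /=.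
apply: eq_bigr => m _; rewrite -/(lext _ _) lext_linear scalerDr !scalerA.
by rewrite [_ * a]mulrC.
Qed.

Lemma tensUU (M N : conomType) (m : M) (n : N) :
  << m >> \ox << n >> = << (m, n) >> :> {malg K[(M * N)%type]}.
Proof. by rewrite tensE !lextU. Qed.

(** Identities involving a tensor p \ox q are all reduced to basis elements
    through this principle. *)
Lemma bilinear_ext (M N : choiceType) (V : lmodType K)
    (f g : {malg K[M]} -> {malg K[N]} -> V) :
    (forall q, linear (f^~ q)) -> (forall p, linear (f p)) ->
    (forall q, linear (g^~ q)) -> (forall p, linear (g p)) ->
    (forall m n, f << m >> << n >> = g << m >> << n >>) ->
  forall p q, f p q = g p q.
Proof.
move=> fl fr gl gr fg p q; move: p.
apply: (linear_ext (fl q) (gl q)) => m; move: q.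
exact: (linear_ext (fr _) (gr _)).
Qed.

Lemma linear_comp (U V W : lmodType K) (f : V -> W) (g : U -> V) :
  linear f -> linear g -> linear (fun u => f (g u)).
Proof. by move=> fL gL a u v; rewrite gL fL. Qed.

Lemma alg_morph_comp (A B C : comAlgType K) (f : B -> C) (g : A -> B) :
  alg_morph f -> alg_morph g -> alg_morph (fun u => f (g u)).
Proof.
move=> [fL f1 fM] [gL g1 gM]; split=> [||p q].
- exact: linear_comp.
- by rewrite g1.
- by rewrite gM.
Qed.

Lemma tensMM (M N : conomType) (p p' : {malg K[M]}) (q q' : {malg K[N]}) :
  (p \ox q) * (p' \ox q') = (p * p') \ox (q * q').
Proof.
have mll (R : comAlgType K) (b : R) : linear (fun a => a * b).
  by move=> c a a'; rewrite mulrDl -scalerAl.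
have mlr (R : comAlgType K) (b : R) : linear (fun a => b * a).
  by move=> c a a'; rewrite mulrDr -scalerAr.
apply: (bilinear_ext (f := fun p q => (p \ox q) * (p' \ox q'))
                     (g := fun p q => (p * p') \ox (q * q'))) => [r|r|r|r|m n].
- exact: linear_comp (mll _ _) (tens_linearl _).
- exact: linear_comp (mll _ _) (tens_linearr _).
- exact: linear_comp (tens_linearl _) (mll _ _).
- exact: linear_comp (tens_linearr _) (mll _ _).
apply: (bilinear_ext (f := fun p' q' => (<< m >> \ox << n >>) * (p' \ox q'))
   (g := fun p' q' => (<< m >> * p') \ox (<< n >> * q'))) => [r|r|r|r|m' n'].
- exact: linear_comp (mlr _ _) (tens_linearl _).
- exact: linear_comp (mlr _ _) (tens_linearr _).
- exact: linear_comp (tens_linearl _) (mlr _ _).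
- exact: linear_comp (tens_linearr _) (mlr _ _).
by rewrite !tensUU !malgUM tensUU.
Qed.

Section TensMap.
Variables (M N M' N' : conomType).
Variables (f : {malg K[M]} -> {malg K[M']}) (g : {malg K[N]} -> {malg K[N']}).

Lemma tens_map_linear : linear (tens_map f g).
Proof. exact: lext_linear. Qed.

Lemma tens_mapU u : tens_map f g << u >> = f << u.1 >> \ox g << u.2 >>.
Proof. exact: lextU. Qed.

Lemma tens_map_tens p q : linear f -> linear g ->
  tens_map f g (p \ox q) = f p \ox g q.
Proof.
move=> fL gL; move: p q; apply: bilinear_ext => [r|r|r|r|m n].
- exact: linear_comp tens_map_linear (tens_linearl _).
- exact: linear_comp tens_map_linear (tens_linearr _).
- exact: linear_comp (tens_linearl _) fL.
- exact: linear_comp (tens_linearr _) gL.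
by rewrite tensUU tens_mapU.
Qed.

Lemma tens_map_morph : alg_morph f -> alg_morph g -> alg_morph (tens_map f g).
Proof.
move=> [fL f1 fM] [gL g1 gM]; apply: lext_morph => [|u v].
  by rewrite -(malg1E K M) -(malg1E K N) f1 g1 !malg1E tensUU.
by rewrite tensMM -fM -gM !malgUM.
Qed.
End TensMap.

Lemma tens_assoc_lext (M N L : conomType) (t : {malg K[((M * N) * L)%type]}) :
  tens_assoc t = lext (fun u => << (u.1.1, (u.1.2, u.2)) >>) t.
Proof. by apply: eq_bigr => u _; rewrite malgZU. Qed.

Lemma tens_assoc_linear (M N L : conomType) : linear (@tens_assoc K M N L).
Proof. by move=> a t t'; rewrite !tens_assoc_lext lext_linear. Qed.

Lemma tens_assoc_tens (M N L : conomType) (p : {malg K[M]}) (q : {malg K[N]})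
    (r : {malg K[L]}) : tens_assoc ((p \ox q) \ox r) = p \ox (q \ox r).
Proof.
move: q r; apply: (bilinear_ext (f := fun q r => tens_assoc ((p \ox q) \ox r))
  (g := fun q r => p \ox (q \ox r))) => [r|r|r|r|n l].
- apply: linear_comp (@tens_assoc_linear _ _ _) _.
  exact: linear_comp (tens_linearl _) (tens_linearr _).
- exact: linear_comp (@tens_assoc_linear _ _ _) (tens_linearr _).
- exact: linear_comp (tens_linearr _) (tens_linearl _).
- exact: linear_comp (tens_linearr _) (tens_linearr _).
move: p; apply: linear_ext => [||m].
- apply: linear_comp (@tens_assoc_linear _ _ _) _.
  exact: linear_comp (tens_linearl _) (tens_linearl _).
- exact: tens_linearl.
by rewrite !tensUU tens_assoc_lext lextU.
Qed.

Lemma tens_mul_linear (M : conomType) : linear (@tens_mul K M).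
Proof. exact: lext_linear. Qed.

Lemma tens_mul_tens (M : conomType) (p q : {malg K[M]}) :
  tens_mul (p \ox q) = p * q.
Proof.
move: p q; apply: bilinear_ext => [r|r|r|r|m n].
- exact: linear_comp (@tens_mul_linear _) (tens_linearl _).
- exact: linear_comp (@tens_mul_linear _) (tens_linearr _).
- by move=> c a a'; rewrite mulrDl -scalerAl.
- by move=> c a a'; rewrite mulrDr -scalerAr.
by rewrite tensUU [LHS]lextU.
Qed.

Lemma tens_forml_lext (M N : conomType) (f : {malg K[M]} -> K)
    (t : {malg K[(M * N)%type]}) :
  tens_forml f t = lext (fun u => f << u.1 >> *: << u.2 >>) t.
Proof. by apply: eq_bigr => u _; rewrite scalerA. Qed.

Lemma tens_formr_lext (M N : conomType) (f : {malg K[N]} -> K)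
    (t : {malg K[(M * N)%type]}) :
  tens_formr f t = lext (fun u => f << u.2 >> *: << u.1 >>) t.
Proof. by apply: eq_bigr => u _; rewrite scalerA. Qed.

Lemma tens_forml_tens (M N : conomType) (f : {malg K[M]} -> K) p
    (q : {malg K[N]}) :
  linear (f : _ -> K^o) -> tens_forml f (p \ox q) = f p *: q.
Proof.
move=> fL; rewrite tens_forml_lext.
move: p q; apply: (bilinear_ext (f := fun p q => lext _ (p \ox q)))
  => [r|r|r|r|m n].
- exact: linear_comp (lext_linear _) (tens_linearl _).
- exact: linear_comp (lext_linear _) (tens_linearr _).
- by move=> a p p'; rewrite fL scalerDl scalerA.
- by move=> a q q'; rewrite scalerDr !scalerA mulrC.
by rewrite tensUU lextU.
Qed.

Lemma tens_formr_tens (M N : conomType) (f : {malg K[N]} -> K)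
    (p : {malg K[M]}) q :
  linear (f : _ -> K^o) -> tens_formr f (p \ox q) = f q *: p.
Proof.
move=> fL; rewrite tens_formr_lext.
move: p q; apply: (bilinear_ext (f := fun p q => lext _ (p \ox q)))
  => [r|r|r|r|m n].
- exact: linear_comp (lext_linear _) (tens_linearl _).
- exact: linear_comp (lext_linear _) (tens_linearr _).
- by move=> a q q'; rewrite scalerDr !scalerA mulrC.
- by move=> a p p'; rewrite fL scalerDl scalerA.
by rewrite tensUU lextU.
Qed.

Lemma counit_morph (M : conomType) :
  alg_morph (@counit K M : {malg K[M]} -> K^o).
Proof.
split=> [a p q||p q]; rewrite /counit.
- by rewrite mcoeffD mcoeffZ.
- by rewrite mcoeff1 eqxx.
- exact: rmorphM.
Qed.

(** Dedekind's independence of characters: if a combination of characters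
    vanishes, subtracting chi_0(y) times the relation at z from the relation
    at y z removes chi_0 and multiplies every other coefficient by
    chi(y) - chi_0(y), which is nonzero for a suitable y. *)
Lemma characters_independent (M : choiceType) (X : Type) (op : X -> X -> X)
    (e : X) (chi : M -> X -> K) :
    (forall m x y, chi m (op x y) = chi m x * chi m y) ->
    (forall m, chi m e = 1) ->
    (forall m m', m != m' -> exists x, chi m x != chi m' x) ->
  forall p q : {malg K[M]},
    (forall x, lext (chi^~ x : _ -> K^o) p = lext (chi^~ x : _ -> K^o) q) ->
  p = q.
Proof.
move=> chiM chi1 sep p q pq; apply/eqP; rewrite -subr_eq0; apply/eqP.
have {pq} r0 x : lext (chi^~ x : _ -> K^o) (p - q) = 0.
  by rewrite (linear_mapB _ _ (lext_linear _)) pq subrr.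
have indep (s : seq M) (c : M -> K) : uniq s ->
    (forall x, \sum_(m <- s) c m * chi m x = 0) -> forall m, m \in s -> c m = 0.
  elim: s c => [//|m0 s IHs] c /= /andP[m0s us] c0.
  have cs m : m \in s -> c m = 0.
    move=> ms; have [|y] := sep m m0; first by apply: contraNneq m0s => <-.
    rewrite -subr_eq0 => neq; apply: (mulIf neq); rewrite mul0r.
    apply: (IHs (fun m => c m * (chi m y - chi m0 y))) => // z.
(* the term of m0 cancels in this difference of two relations *)
    transitivity (\sum_(i <- m0 :: s) c i * chi i (op y z)
                  - chi m0 y * \sum_(i <- m0 :: s) c i * chi i z).
      rewrite !big_cons mulrDr chiM mulrCA opprD addrACA subrr add0r.
      rewrite mulr_sumr -sumrB; apply: eq_bigr => i _.
      by rewrite chiM mulrBr mulrBl !mulrA [chi m0 y * _]mulrC.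
    by rewrite !c0 mulr0 subrr.
  move=> m; rewrite inE => /orP[/eqP ->|]; last exact: cs.
  move: (c0 e); rewrite big_cons chi1 mulr1 big1_seq ?addr0 // => i /andP[_ si].
  by rewrite cs // mul0r.
apply/malgP => m; rewrite mcoeff0; case: msuppP => // mr.
exact: (indep (msupp (p - q)) (fun m => (p - q)@_m)).
Qed.

End TensorTheory.

(** * Transport of a Hopf structure onto the image of an algebra morphism *)

Section Transport.
Variable K : fieldType.

Lemma eq_tens_map (M N M' N' : conomType)
    (f f' : {malg K[M]} -> {malg K[M']}) (g g' : {malg K[N]} -> {malg K[N']}) :
  f =1 f' -> g =1 g' -> tens_map f g =1 tens_map f' g'.
Proof. by move=> ff' gg' t; apply: eq_bigr => u _; rewrite ff' gg'. Qed.

Lemma tens_map_comp (M N M' N' M'' N'' : conomType)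
    (f : {malg K[M']} -> {malg K[M'']}) (g : {malg K[N']} -> {malg K[N'']})
    (f' : {malg K[M]} -> {malg K[M']}) (g' : {malg K[N]} -> {malg K[N']}) t :
  linear f -> linear g ->
  tens_map f g (tens_map f' g' t) = tens_map (f \o f') (g \o g') t.
Proof.
move=> fL gL; move: t; apply: linear_ext => [||u].
- exact: linear_comp (@tens_map_linear _ _ _ _ _ _ _)
                     (@tens_map_linear _ _ _ _ _ _ _).
- exact: tens_map_linear.
by rewrite !tens_mapU tens_map_tens.
Qed.

Lemma tens_assoc_map (M N L M' N' L' : conomType)
    (f : {malg K[M]} -> {malg K[M']}) (g : {malg K[N]} -> {malg K[N']})
    (h : {malg K[L]} -> {malg K[L']}) t :
  tens_assoc (tens_map (tens_map f g) h t) =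
  tens_map f (tens_map g h) (tens_assoc t).
Proof.
move: t; apply: linear_ext => [||[[m n] l]].
- exact: linear_comp (@tens_assoc_linear _ _ _ _)
                     (@tens_map_linear _ _ _ _ _ _ _).
- exact: linear_comp (@tens_map_linear _ _ _ _ _ _ _)
                     (@tens_assoc_linear _ _ _ _).
rewrite tens_mapU /= tens_mapU tens_assoc_tens.
by rewrite tens_assoc_lext lextU !tens_mapU.
Qed.

Variables (N M : conomType).
Variables (DeltaN : {malg K[N]} -> {malg K[(N * N)%type]})
  (epsN : {malg K[N]} -> K) (SN : {malg K[N]} -> {malg K[N]}).
Variables (C : {malg K[M]} -> Prop)
  (DeltaM : {malg K[M]} -> {malg K[(M * M)%type]})
  (epsM : {malg K[M]} -> K) (SM : {malg K[M]} -> {malg K[M]}).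
Variable phi : {malg K[N]} -> {malg K[M]}.

Hypothesis phiA : alg_morph phi.
Hypothesis DeltaMA : alg_morph DeltaM.
Hypothesis epsMA : alg_morph (epsM : _ -> K^o).
Hypothesis SML : linear SM.
Hypothesis C_image : forall p, C p <-> exists q, p = phi q.
Hypothesis Delta_phi : forall q, DeltaM (phi q) = tens_map phi phi (DeltaN q).
Hypothesis eps_phi : forall q, epsM (phi q) = epsN q.
Hypothesis S_phi : forall q, SM (phi q) = phi (SN q).

(** Every element of C is some phi q, and each axiom for phi q is the image
    under phi of the same axiom for q. *)
Lemma hopf_transport :
  hopf_subalgebra (@full {malg K[N]}) DeltaN epsN SN ->
  hopf_subalgebra C DeltaM epsM SM.
Proof.
case: phiA DeltaMA epsMA => phiL phi1 phiM [DL D1 DM] [eL e1 eM].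
move=> [_ _ _ _ _ DNL _ _ eNL _ _ SNL coA cul cur Sl Sr].
have mapL := @tens_map_linear K.
have mulphi t : tens_mul (tens_map phi phi t) = phi (tens_mul t).
  move: t; apply: linear_ext => [||[a b]].
  - exact: linear_comp (@tens_mul_linear _ _) (mapL _ _ _ _ _ _).
  - exact: linear_comp phiL (@tens_mul_linear _ _).
  by rewrite tens_mapU -tensUU !tens_mul_tens phiM.
split.
- move=> a _ _ /C_image[p ->] /C_image[q ->]; apply/C_image.
  by exists (a *: p + q); rewrite phiL.
- by apply/C_image; exists 1.
- move=> _ _ /C_image[p ->] /C_image[q ->]; apply/C_image.
  by exists (p * q); rewrite phiM.
- move=> _ /C_image[q ->]; rewrite Delta_phi.
  exists [seq ((DeltaN q)@_u *: phi << u.1 >>, phi << u.2 >>)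
         | u <- msupp (DeltaN q)]; split.
    move=> _ /mapP[u _ ->] /=; split; apply/C_image; last by eexists.
    by exists ((DeltaN q)@_u *: << u.1 >>); rewrite linear_mapZ.
  rewrite big_map; apply: eq_bigr => u _ /=.
  by rewrite (linear_mapZ _ _ (tens_linearl _)).
- move=> _ /C_image[q ->]; rewrite S_phi; apply/C_image.
  by exists (SN q).
- exact: DL.
- exact: D1.
- exact: DM.
- exact: eL.
- exact: e1.
- exact: eM.
- exact: SML.
- move=> _ /C_image[q ->]; rewrite Delta_phi.
  rewrite !tens_map_comp //.
  rewrite (eq_tens_map (f' := tens_map phi phi \o DeltaN) (g' := phi \o id)) //.
  rewrite -(tens_map_comp DeltaN id _ (mapL _ _ _ _ phi phi) phiL).
  rewrite tens_assoc_map (coA q I).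
  rewrite (tens_map_comp id DeltaN _ phiL (mapL _ _ _ _ phi phi)).
  by apply: eq_tens_map => // p; rewrite /= Delta_phi.
- move=> _ /C_image[q ->]; rewrite Delta_phi -[in RHS](cul q) //.
  move: (DeltaN q); apply: linear_ext => [c t t'|c t t'|[a b]].
  + by rewrite mapL !tens_forml_lext lext_linear.
  + by rewrite !tens_forml_lext lext_linear phiL.
  rewrite tens_mapU tens_forml_tens // -tensUU tens_forml_tens //= eps_phi.
  by rewrite (linear_mapZ _ _ phiL).
- move=> _ /C_image[q ->]; rewrite Delta_phi -[in RHS](cur q) //.
  move: (DeltaN q); apply: linear_ext => [c t t'|c t t'|[a b]].
  + by rewrite mapL !tens_formr_lext lext_linear.
  + by rewrite !tens_formr_lext lext_linear phiL.
  rewrite tens_mapU tens_formr_tens // -tensUU tens_formr_tens //= eps_phi.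
  by rewrite (linear_mapZ _ _ phiL).
- move=> _ /C_image[q ->]; rewrite Delta_phi tens_map_comp //.
  rewrite (eq_tens_map (f' := phi \o SN) (g' := phi \o id)) //.
  rewrite -tens_map_comp // mulphi Sl // eps_phi.
  by rewrite (linear_mapZ _ _ phiL) phi1.
- move=> _ /C_image[q ->]; rewrite Delta_phi tens_map_comp //.
  rewrite (eq_tens_map (f' := phi \o id) (g' := phi \o SN)) //.
  rewrite -tens_map_comp // mulphi Sr // eps_phi.
  by rewrite (linear_mapZ _ _ phiL) phi1.
Qed.
End Transport.

(** * Composition and inversion of formal power series *)

Section PowerCoefficients.
Variable R : comNzRingType.
Implicit Types (u : nat -> R).

(** The coefficient of h^n in the k-th power of sum_i u_i h^i.  It is
    [series_pow] over a commutative ring, so that it also applies to the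
    universal series, whose coefficients lie in the Faa di Bruno algebra, and
    to the series of corollas. *)
Fixpoint cpow u (k n : nat) : R :=
  if k is k'.+1 then \sum_(i < n.+1) u i * cpow u k' (n - i)%N
  else (n == 0%N)%:R.

Lemma eq_cpow u v k : u =1 v -> cpow u k =1 cpow v k.
Proof.
move=> uv; elim: k => //= k IHk n.
by apply: eq_bigr => i _; rewrite uv IHk.
Qed.

Lemma cpow_small u k n : u 0%N = 0 -> (n < k)%N -> cpow u k n = 0.
Proof.
move=> u0; elim: k n => //= k IHk n nk; apply: big1 => -[[|i] /= ni] _.
  by rewrite u0 mul0r.
by rewrite IHk ?mulr0 //; lia.
Qed.

Lemma cpow_diag u n : u 0%N = 0 -> u 1%N = 1 -> cpow u n n = 1.
Proof.
move=> u0 u1; elim: n => [|n IHn] //=.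
rewrite 2!big_ord_recl /= u0 mul0r add0r u1 mul1r subSS subn0 IHn.
rewrite big1 ?addr0 // => i _.
by rewrite cpow_small ?mulr0 // /bump /=; have := ltn_ord i; lia.
Qed.

Definition eqmodX N u (p : {poly R}) := forall n, (n < N)%N -> u n = p`_n.

Lemma cpow_eqmodX N u p k : eqmodX N u p -> eqmodX N (cpow u k) (p ^+ k).
Proof.
move=> up; elim: k => [|k IHk] n nN /=; first by rewrite expr0 coef1.
rewrite exprS coefM; apply: eq_bigr => -[i /= ni] _.
by rewrite up ?IHk //; lia.
Qed.

Lemma eqmodX_trunc N u : eqmodX N u (\poly_(i < N) u i).
Proof. by move=> n nN; rewrite coef_poly nN. Qed.

(** The first n coefficients of the series Q such that Q o P = h, for P in
    G_1.  As the coefficient of h^n in P^n is 1, comparing coefficients of h^n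
    expresses Q_n through the earlier Q_k; a list carries those earlier
    values, the recursion being on all smaller indices. *)
Fixpoint inv_prefix u (n : nat) : seq R :=
  if n is n'.+1 then
    let s := inv_prefix u n' in
    rcons s ((n' == 1%N)%:R - \sum_(k < n') s`_k * cpow u k n')
  else [::].

Definition linv u n : R := (inv_prefix u n.+1)`_n.

Lemma size_inv_prefix u n : size (inv_prefix u n) = n.
Proof. by elim: n => //= n IHn; rewrite size_rcons IHn. Qed.

Lemma nth_inv_prefix u n k : (k < n)%N -> (inv_prefix u n)`_k = linv u k.
Proof.
elim: n => // n IHn; rewrite ltnS leq_eqVlt => /orP[/eqP -> //|kn].
by rewrite /= nth_rcons size_inv_prefix kn IHn.
Qed.

Lemma linvE u n :
  linv u n = (n == 1%N)%:R - \sum_(k < n) linv u k * cpow u k n.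
Proof.
rewrite {1}/linv /= nth_rcons size_inv_prefix ltnn eqxx.
by congr (_ - _); apply: eq_bigr => k _; rewrite nth_inv_prefix.
Qed.

Lemma eq_linv u v : u =1 v -> linv u =1 linv v.
Proof.
move=> uv n; have [d] := ubnP n; elim: d n => // d IHd n nd.
rewrite !linvE; congr (_ - _); apply: eq_bigr => k _.
by rewrite IHd ?(eq_cpow _ uv) //; have := ltn_ord k; lia.
Qed.
End PowerCoefficients.

(** A ring morphism commutes with the coefficients of powers and of inverses,
    these being polynomials in the coefficients of the series; this is what
    lets the universal series specialise to each point of G_1. *)
Section MorphCoefficients.
Variables (R S : comNzRingType) (f : R -> S).
Hypothesis f0 : f 0 = 0.
Hypothesis f1 : f 1 = 1.
Hypothesis fB : forall p q, f (p - q) = f p - f q.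
Hypothesis fM : forall p q, f (p * q) = f p * f q.

Let fD p q : f (p + q) = f p + f q.
Proof.
have fN : f (- q) = - f q by rewrite -[- q]sub0r fB f0 sub0r.
by rewrite -{1}[q]opprK fB fN opprK.
Qed.

Lemma morph_cpow u k n : f (cpow u k n) = cpow (f \o u) k n.
Proof.
elim: k n => [|k IHk] n /=; first by case: eqP.
by rewrite (big_morph f fD f0); apply: eq_bigr => i _; rewrite fM IHk.
Qed.

Lemma morph_linv u n : f (linv u n) = linv (f \o u) n.
Proof.
have [d] := ubnP n; elim: d n => // d IHd n nd.
rewrite [linv u n]linvE linvE fB (big_morph f fD f0); congr (_ - _).
  by case: eqP.
by apply: eq_bigr => k _; rewrite fM morph_cpow IHd //; have := ltn_ord k; lia.
Qed.
End MorphCoefficients.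

Section Composition.
Variable K : fieldType.
Implicit Types P Q T : nat -> K.

Lemma series_compE Q P n : series_comp Q P n = \sum_(k < n.+1) Q k * cpow P k n.
Proof.
apply: eq_bigr => k _; congr (_ * _).
move: (k : nat) {2 4}n => {}k; elim: k => //= k IHk j.
by apply: eq_bigr => i _; rewrite -IHk.
Qed.

Lemma eq_series_comp Q Q' P P' : Q =1 Q' -> P =1 P' ->
  series_comp Q P =1 series_comp Q' P'.
Proof.
move=> QQ' PP' n; rewrite !series_compE; apply: eq_bigr => k _.
by rewrite QQ' (eq_cpow _ PP').
Qed.

(** As P has no constant term, p^k starts in degree k at least; the terms of
    q \Po p of index above n therefore do not contribute to degree n. *)
Lemma series_comp_eqmodX N Q P (q p : {poly K}) : P 0%N = 0 ->
  eqmodX N Q q -> eqmodX N P p -> eqmodX N (series_comp Q P) (q \Po p).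
Proof.
move=> P0 Qq Pp n nN; have p0 : p`_0 = 0 by rewrite -Pp //; lia.
have pk k : (n < k)%N -> (p ^+ k)`_n = 0.
  move=> nk; rewrite -(cpow_eqmodX (u := fun i => p`_i) (N := n.+1)) //.
  by rewrite cpow_small.
rewrite series_compE coef_comp_poly.
transitivity (\sum_(i < maxn (size q) n.+1) q`_i * (p ^+ i)`_n).
  rewrite (big_ord_widen _ (fun i => Q i * cpow P i n) (leq_maxr (size q) _)).
  rewrite big_mkcond /=; apply: eq_bigr => i _; rewrite ltnS.
  case: leqP => [iN|/pk ->]; last by rewrite mulr0.
  by rewrite Qq ?(cpow_eqmodX _ Pp) //; lia.
rewrite [RHS](big_ord_widen _ (fun i => q`_i * (p ^+ i)`_n) (leq_maxl _ n.+1)).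
rewrite [RHS]big_mkcond /=; apply: eq_bigr => i _.
by case: ltnP => // iq; rewrite nth_default ?mul0r.
Qed.

(** In each degree this is the associativity of the composition of
    polynomials, applied to truncations. *)
Lemma series_compA T Q P : P 0%N = 0 -> Q 0%N = 0 ->
  series_comp (series_comp T Q) P =1 series_comp T (series_comp Q P).
Proof.
move=> P0 Q0 n.
have trunc := @eqmodX_trunc K n.+1.
have [t q p] := And3 (trunc T) (trunc Q) (trunc P).
have QP0 : series_comp Q P 0%N = 0 by rewrite series_compE big_ord1 Q0 mul0r.
rewrite (series_comp_eqmodX P0 (series_comp_eqmodX Q0 t q) p) //.
by rewrite (series_comp_eqmodX QP0 t (series_comp_eqmodX P0 q p)) // comp_polyA.
Qed.

Definition series_id : nat -> K := fun n => (n == 1%N)%:R.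

Lemma cpow_id k n : cpow series_id k n = (n == k)%:R.
Proof.
elim: k n => [|k IHk] n //=; case: n => [|n].
  by rewrite big_ord1 mul0r.
rewrite 2!big_ord_recl /= mul0r add0r mul1r IHk subSS subn0 eqSS.
by rewrite big1 ?addr0 // => i _; rewrite mul0r.
Qed.

Lemma series_compf1 Q : series_comp Q series_id =1 Q.
Proof.
move=> n; rewrite series_compE big_ord_recr /= cpow_id eqxx mulr1.
rewrite big1 ?add0r //.
by move=> [i /= ni] _; rewrite cpow_id gtn_eqF ?mulr0.
Qed.

Lemma series_comp1f P : P 0%N = 0 -> series_comp series_id P =1 P.
Proof.
move=> P0 [|n]; rewrite series_compE; first by rewrite big_ord1 mul0r P0.
rewrite 2!big_ord_recl /= mul0r add0r mul1r.
rewrite [in X in _ + X]big1 ?addr0 => [|i _]; last by rewrite mul0r.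
rewrite big_ord_recr /= subnn mulr1 big1 ?add0r // => i _.
by rewrite (gtn_eqF (m := 0)) ?mulr0 // subn_gt0.
Qed.

Lemma series_comp_G1 Q P : in_G1 P -> in_G1 Q -> in_G1 (series_comp Q P).
Proof.
move=> [P0 P1] [Q0 Q1]; split; rewrite series_compE.
  by rewrite big_ord1 Q0 mul0r.
rewrite 2!big_ord_recl big_ord0 /= !big_ord_recl big_ord0 /= Q0 Q1 P0 P1.
by rewrite !(mul0r, mul1r, add0r, addr0).
Qed.

Lemma linv_G1 P : in_G1 P -> in_G1 (linv P).
Proof.
have l0 : linv P 0 = 0 by rewrite linvE big_ord0 subr0.
by split=> //; rewrite linvE big_ord1 l0 mul0r subr0.
Qed.

Lemma linv_compl P : in_G1 P -> series_comp (linv P) P =1 series_id.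
Proof.
move=> [P0 P1] n; rewrite series_compE big_ord_recr /= cpow_diag // mulr1.
by rewrite [linv P n]linvE addrC subrK.
Qed.

(** The group argument: if Q is a left inverse of P and R one of Q, then
    R = R o (Q o P) = (R o Q) o P = P. *)
Lemma linv_compr P : in_G1 P -> series_comp P (linv P) =1 series_id.
Proof.
move=> PG; have [QG [P0 P1]] := (linv_G1 PG, PG).
have [Q0 _] := QG; have [R0 _] := linv_G1 QG.
suff PE : linv (linv P) =1 P.
  by move=> n; rewrite -(linv_compl QG n); apply: eq_series_comp.
move=> n; rewrite -(series_compf1 (linv (linv P)) n).
rewrite -(eq_series_comp (fun=> erefl) (linv_compl PG)) -series_compA //.
by rewrite (eq_series_comp (linv_compl QG) (fun=> erefl)) series_comp1f.
Qed.
End Composition.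

(** * The Faa di Bruno Hopf algebra *)

Section FaaDiBruno.
Variable K : fieldType.
Local Notation F := (HFdB K).
Implicit Types (P Q R : nat -> K) (f p q : F) (m : {cmonom nat}).

(** The universal series of G_1, by coefficients: [Sigma n] is the
    coefficient of h^n, that is Sigma_(n-1) if n > 0. *)
Definition Sigma (n : nat) : F :=
  match n with 0 => 0 | 1 => 1 | i.+2 => << ucm i >> end.

Definition fdb_Delta : F -> HFdB2 K :=
  poly_ext (fun i => \sum_(k < i.+3) cpow Sigma k i.+2 \ox Sigma k).

Definition fdb_antipode : F -> F := poly_ext (fun i => linv Sigma i.+2).

Lemma fdb_eval_morph P : alg_morph (fdb_eval P : F -> K^o).
Proof.
apply: (lext_morph (A := K^o : comAlgType K)); first exact: mon_eval1.
exact: mon_evalM.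
Qed.

Lemma fdb_evalU P m : fdb_eval P << m >> = mon_eval (Sigma_coord P) m.
Proof. exact: (lextU (V := K^o)). Qed.

Lemma fdb_eval2_morph P Q : alg_morph (fdb_eval2 P Q : HFdB2 K -> K^o).
Proof.
apply: (lext_morph (A := K^o : comAlgType K)).
  by rewrite !mon_eval1 mulr1.
by move=> u v; rewrite !mon_evalM mulrACA.
Qed.

Lemma fdb_eval2U P Q u : fdb_eval2 P Q << u >> =
  mon_eval (Sigma_coord P) u.1 * mon_eval (Sigma_coord Q) u.2.
Proof. exact: (lextU (V := K^o)). Qed.

Lemma fdb_eval2_tens P Q p q :
  fdb_eval2 P Q (p \ox q) = fdb_eval P p * fdb_eval Q q.
Proof.
have [[L2 _ _] [LP _ _] [LQ _ _]] :=
  And3 (fdb_eval2_morph P Q) (fdb_eval_morph P) (fdb_eval_morph Q).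
move: p q; apply: (bilinear_ext (V := K^o)
  (g := fun p q => fdb_eval P p * fdb_eval Q q)) => [q|p|q|p|m n].
- exact: linear_comp L2 (tens_linearl q).
- exact: linear_comp L2 (tens_linearr p).
- move=> a p p'; rewrite LP [LHS]mulrDl; congr (_ + _); exact/esym/mulrA.
- move=> a q q'; rewrite LQ [LHS]mulrDr; congr (_ + _); exact: mulrCA.
by rewrite tensUU !fdb_evalU fdb_eval2U.
Qed.

Lemma fdb_eval_Sigma P n : in_G1 P -> fdb_eval P (Sigma n) = P n.
Proof.
move=> [P0 P1]; have [L E1 _] := fdb_eval_morph P.
case: n => [|[|n]]; last by rewrite fdb_evalU mon_evalU.
  by rewrite P0 (linear_map0 L).
by rewrite P1 -E1.
Qed.

Lemma fdb_eval_cpow P k n : in_G1 P -> fdb_eval P (cpow Sigma k n) = cpow P k n.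
Proof.
move=> PG; have [L E1 M] := fdb_eval_morph P.
rewrite (morph_cpow (linear_map0 L) E1 _ M) => [|p q].
  by apply: eq_cpow => i; apply: fdb_eval_Sigma.
exact: linear_mapB L.
Qed.

Lemma fdb_eval_linv P n : in_G1 P -> fdb_eval P (linv Sigma n) = linv P n.
Proof.
move=> PG; have [L E1 M] := fdb_eval_morph P.
rewrite (morph_linv (linear_map0 L) E1 _ M) => [|p q].
  by apply: eq_linv => i; apply: fdb_eval_Sigma.
exact: linear_mapB L.
Qed.

Lemma fdb_Delta_morph : alg_morph fdb_Delta.
Proof. exact: poly_ext_morph. Qed.

(** Both sides are algebra morphisms in f; on a generator the claim is the
    definition of the composition of series. *)
Lemma fdb_DeltaP : fdb_comul fdb_Delta.
Proof.
move=> f P Q PG QG.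
have [EL _ _] := fdb_eval2_morph P Q.
move: f; apply: (alg_morph_ext (A := K^o : comAlgType K)) => [||i].
- exact: alg_morph_comp (fdb_eval2_morph P Q) fdb_Delta_morph.
- exact: fdb_eval_morph.
rewrite [fdb_Delta _]poly_extU fdb_evalU mon_evalU /Sigma_coord series_compE.
rewrite (linear_map_sum _ _ _ EL); apply: eq_bigr => k _.
by rewrite fdb_eval2_tens fdb_eval_cpow // fdb_eval_Sigma // mulrC.
Qed.

Lemma fdb_antipodeP P f : in_G1 P ->
  fdb_eval P (fdb_antipode f) = fdb_eval (linv P) f.
Proof.
move=> PG; move: f; apply: (alg_morph_ext (A := K^o : comAlgType K)) => [||i].
- exact: alg_morph_comp (fdb_eval_morph P) (poly_ext_morph _).
- exact: fdb_eval_morph.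
by rewrite [fdb_antipode _]poly_extU fdb_evalU mon_evalU fdb_eval_linv.
Qed.

Lemma counit_eval f : counit f = fdb_eval (@series_id K) f.
Proof.
move: f; apply: (alg_morph_ext (A := K^o : comAlgType K)) => [||i].
- exact: counit_morph.
- exact: fdb_eval_morph.
by rewrite fdb_evalU mon_evalU /counit mcoeffU1 cm1_eq1.
Qed.

Hypothesis charK : [pchar K]%R =i pred0.

(** The powers of 2 are used below as coordinates telling exponents apart. *)
Lemma pow2_inj : injective (fun n : nat => 2%:R ^+ n : K).
Proof.
have natr_inj : injective (fun n : nat => n%:R : K).
  have nz := (pcharf0P K).1 charK.
  suff le (m n : nat) : (m <= n)%N -> m%:R = n%:R :> K -> m = n.
    move=> m n mn; case/orP: (leq_total m n) => /le; first by apply.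
    by move=> /(_ (esym mn)).
  move=> mn /eqP; rewrite eq_sym -subr_eq0 -natrB // nz subn_eq0 => nm.
  by apply/eqP; rewrite eqn_leq mn.
move=> m n /=; rewrite -!natrX => /natr_inj /eqP.
by rewrite eqn_exp2l // => /eqP.
Qed.

(** Give the value 2 to one generator on which the exponents differ, and 1 to
    the others. *)
Lemma mon_eval_sep (m m' : {cmonom nat}) : m != m' ->
  exists v : nat -> K, mon_eval v m != mon_eval v m'.
Proof.
move=> neq; have [i mi] : exists i, m i != m' i.
  case: (boolP [exists i : (finsupp m `|` finsupp m')%fset,
                  m (val i) != m' (val i)]).
    by move/existsP => [i mi]; exists (val i).
  rewrite negb_exists => /forallP /= E; case/negP: neq; apply/cmP => i.
  have [im|] := boolP (i \in (finsupp m `|` finsupp m')%fset).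
    by have := E [` im]%fset; rewrite negbK => /eqP.
  rewrite in_fsetU negb_or -!cmE_eq0 => /andP[/eqP -> /eqP ->] //.
pose v j : K := if j == i then 2%:R else 1.
have vE (n : {cmonom nat}) : mon_eval v n = 2%:R ^+ n i.
  rewrite (mon_evalEw v (fsubsetUr [fset i]%fset (finsupp n))).
  rewrite (big_fsetD1 i) /= ?fset1U1 // /v eqxx big1_fset ?mulr1 // => j.
  by rewrite in_fsetD1 => /andP[/negPf -> _] _; rewrite expr1n.
by exists v; rewrite !vE; apply: contraNneq mi => /pow2_inj ->.
Qed.

(* the point of G1 with coordinates v *)
Definition G1_point (v : nat -> K) (n : nat) : K :=
  match n with 0 => 0 | 1 => 1 | i.+2 => v i end.

Lemma mon_eval_one (I : choiceType) (m : {cmonom I}) :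
  mon_eval (fun=> 1 : K) m = 1.
Proof. by rewrite /mon_eval big1 // => i _; rewrite expr1n. Qed.

Lemma fdb_eval_inj p q :
  (forall P, in_G1 P -> fdb_eval P p = fdb_eval P q) -> p = q.
Proof.
move=> pq.
apply: (@characters_independent K _ (nat -> K) (fun v w i => v i * w i)
  (fun=> 1) (fun m v => mon_eval v m)) => [m v w|m|m m'|v].
- exact: mon_eval_vM.
- exact: mon_eval_one.
- exact: mon_eval_sep.
- exact: (pq (G1_point v)).
Qed.

Lemma fdb_eval2_inj s t :
    (forall P Q, in_G1 P -> in_G1 Q -> fdb_eval2 P Q s = fdb_eval2 P Q t) ->
  s = t.
Proof.
move=> st.
apply: (@characters_independent K _ ((nat -> K) * (nat -> K))%type
  (fun v w => (fun i => v.1 i * w.1 i, fun i => v.2 i * w.2 i))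
  (fun=> 1, fun=> 1) (fun u v => mon_eval v.1 u.1 * mon_eval v.2 u.2))
  => [u v w|u|u u'|v].
- by rewrite !mon_eval_vM mulrACA.
- by rewrite !mon_eval_one mulr1.
- case: u u' => [m n] [m' n']; rewrite xpair_eqE negb_and.
  case/orP => /mon_eval_sep[v].
    by exists (v, fun=> 1); rewrite !mon_eval_one !mulr1.
  by exists (fun=> 1, v); rewrite !mon_eval_one !mul1r.
- exact: (st (G1_point v.1) (G1_point v.2)).
Qed.

Definition fdb_eval3 P Q R
    (t : {malg K[({cmonom nat} * ({cmonom nat} * {cmonom nat}))%type]}) : K :=
  lext (fun u => mon_eval (Sigma_coord P) u.1 *
    (mon_eval (Sigma_coord Q) u.2.1 * mon_eval (Sigma_coord R) u.2.2) : K^o) t.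

Lemma fdb_eval3_inj s t :
  (forall P Q R, in_G1 P -> in_G1 Q -> in_G1 R ->
     fdb_eval3 P Q R s = fdb_eval3 P Q R t) -> s = t.
Proof.
move=> st.
apply: (@characters_independent K _
  ((nat -> K) * ((nat -> K) * (nat -> K)))%type
  (fun v w => (fun i => v.1 i * w.1 i,
              (fun i => v.2.1 i * w.2.1 i, fun i => v.2.2 i * w.2.2 i)))
  (fun=> 1, (fun=> 1, fun=> 1))
  (fun u v => mon_eval v.1 u.1 * (mon_eval v.2.1 u.2.1 * mon_eval v.2.2 u.2.2)))
  => [u v w|u|u u'|v].
- by rewrite !mon_eval_vM [RHS]mulrACA [X in _ = _ * X]mulrACA.
- by rewrite !mon_eval_one !mulr1.
- case: u u' => [m [n l]] [m' [n' l']]; rewrite xpair_eqE negb_and => /orP[|].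
    move=> /mon_eval_sep[v vP]; exists (v, (fun=> 1, fun=> 1)).
    by rewrite !mon_eval_one !mulr1.
  rewrite xpair_eqE negb_and => /orP[] /mon_eval_sep[v vP].
    by exists (fun=> 1, (v, fun=> 1)); rewrite !mon_eval_one !mul1r !mulr1.
  by exists (fun=> 1, (fun=> 1, v)); rewrite !mon_eval_one !mul1r.
- exact: (st (G1_point v.1) (G1_point v.2.1) (G1_point v.2.2)).
Qed.

Lemma fdb_Delta_unique Delta : fdb_comul Delta -> Delta =1 fdb_Delta.
Proof.
move=> DP f; apply: fdb_eval2_inj => P Q PG QG.
by rewrite DP // fdb_DeltaP.
Qed.

Lemma fdb_eval3_tensl P Q R s r :
  fdb_eval3 P Q R (tens_assoc (s \ox r)) = fdb_eval2 P Q s * fdb_eval R r.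
Proof.
have [[L2 _ _] [LR _ _]] := (fdb_eval2_morph P Q, fdb_eval_morph R).
have L3 : linear (fdb_eval3 P Q R : _ -> K^o) by apply: lext_linear.
have LA := linear_comp L3 (@tens_assoc_linear K _ _ _).
move: s r; apply: (bilinear_ext (V := K^o)
  (f := fun s r => fdb_eval3 P Q R (tens_assoc (s \ox r)))
  (g := fun s r => fdb_eval2 P Q s * fdb_eval R r)) => [q|p|q|p|[m n] l].
- exact: linear_comp LA (tens_linearl q).
- exact: linear_comp LA (tens_linearr p).
- move=> a p p'; rewrite L2 [LHS]mulrDl; congr (_ + _); exact/esym/mulrA.
- move=> a q q'; rewrite LR [LHS]mulrDr; congr (_ + _); exact: mulrCA.
rewrite tensUU tens_assoc_lext lextU /fdb_eval3 lextU fdb_evalU.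
by rewrite fdb_eval2U mulrA.
Qed.

Lemma fdb_eval3_tensr P Q R p t :
  fdb_eval3 P Q R (p \ox t) = fdb_eval P p * fdb_eval2 Q R t.
Proof.
have [[L2 _ _] [LR _ _]] := (fdb_eval2_morph Q R, fdb_eval_morph P).
have L3 : linear (fdb_eval3 P Q R : _ -> K^o) by apply: lext_linear.
move: p t; apply: (bilinear_ext (V := K^o)
  (f := fun s r => fdb_eval3 P Q R (s \ox r))
  (g := fun s r => fdb_eval P s * fdb_eval2 Q R r)) => [q|p|q|p|l [m n]].
- exact: linear_comp L3 (tens_linearl q).
- exact: linear_comp L3 (tens_linearr p).
- move=> a p p'; rewrite LR [LHS]mulrDl; congr (_ + _); exact/esym/mulrA.
- move=> a q q'; rewrite L2 [LHS]mulrDr; congr (_ + _); exact: mulrCA.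
rewrite tensUU /fdb_eval3 lextU fdb_evalU.
by rewrite fdb_eval2U.
Qed.

Lemma eq_fdb_eval P P' f : P =1 P' -> fdb_eval P f = fdb_eval P' f.
Proof.
move=> PP'; apply: eq_bigr => m _; congr (_ * _).
by apply: eq_bigr => i _; rewrite /Sigma_coord PP'.
Qed.

(** At points P, Q, R of G_1, the two sides of coassociativity are the values
    of f at R o (Q o P) and at (R o Q) o P; the counit is evaluation at h, and
    the antipode is evaluation at the inverse. *)
Lemma fdb_hopf : hopf_subalgebra (@full F) fdb_Delta (@counit K _) fdb_antipode.
Proof.
have [DL D1 DM] := fdb_Delta_morph.
have [eL e1 eM] := @counit_morph K {cmonom nat}.
have [SL _ _] : alg_morph fdb_antipode by apply: poly_ext_morph.
have mapL := @tens_map_linear K.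
split=> //.
- move=> p _; exists [seq ((fdb_Delta p)@_u *: << u.1 >>, << u.2 >>)
                     | u <- msupp (fdb_Delta p)]; split=> //.
  rewrite big_map {1}[fdb_Delta p]monalgE; apply: eq_bigr => -[m n] _ /=.
  by rewrite malgZU (linear_mapZ _ _ (tens_linearl _)) tensUU.
- move=> f _; apply: fdb_eval3_inj => P Q R PG QG RG.
  have [[P0 _] [Q0 _]] := (PG, QG).
  have L3 : linear (fdb_eval3 P Q R : _ -> K^o) by apply: lext_linear.
  transitivity (fdb_eval2 (series_comp Q P) R (fdb_Delta f)).
    move: (fdb_Delta f); apply: (linear_ext (V := K^o)) => [||[a b]].
    - exact: linear_comp (linear_comp L3 (@tens_assoc_linear K _ _ _))
                         (mapL _ _ _ _ _ _).
    - by have [] := fdb_eval2_morph (series_comp Q P) R.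
    by rewrite tens_mapU fdb_eval3_tensl fdb_DeltaP // -tensUU fdb_eval2_tens.
  transitivity (fdb_eval2 P (series_comp R Q) (fdb_Delta f)).
    rewrite !fdb_DeltaP //; do ?exact: series_comp_G1.
    by apply: eq_fdb_eval => n; rewrite series_compA.
  move: (fdb_Delta f); apply: (linear_ext (V := K^o)) => [||[a b]].
  - by have [] := fdb_eval2_morph P (series_comp R Q).
  - exact: linear_comp L3 (mapL _ _ _ _ _ _).
  by rewrite tens_mapU fdb_eval3_tensr fdb_DeltaP // -tensUU fdb_eval2_tens.
- move=> f _; apply: fdb_eval_inj => Q QG; have [L _ _] := fdb_eval_morph Q.
  transitivity (fdb_eval2 (@series_id K) Q (fdb_Delta f)).
    move: (fdb_Delta f); apply: (linear_ext (V := K^o)) => [||[a b]].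
    - apply: linear_comp L _ => c t t'.
      by rewrite !tens_forml_lext lext_linear.
    - by have [] := fdb_eval2_morph (@series_id K) Q.
    rewrite -tensUU fdb_eval2_tens tens_forml_tens // counit_eval.
    by rewrite (linear_mapZ _ _ L).
  rewrite fdb_DeltaP //; apply: eq_fdb_eval => n; exact: series_compf1.
- move=> f _; apply: fdb_eval_inj => Q QG; have [L _ _] := fdb_eval_morph Q.
  transitivity (fdb_eval2 Q (@series_id K) (fdb_Delta f)).
    move: (fdb_Delta f); apply: (linear_ext (V := K^o)) => [||[a b]].
    - apply: linear_comp L _ => c t t'.
      by rewrite !tens_formr_lext lext_linear.
    - by have [] := fdb_eval2_morph Q (@series_id K).
    rewrite -tensUU fdb_eval2_tens tens_formr_tens // counit_eval.
    by rewrite (linear_mapZ _ _ L) mulrC.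
  rewrite fdb_DeltaP //; apply: eq_fdb_eval => n.
  by rewrite series_comp1f //; case: QG.
- move=> f _; apply: fdb_eval_inj => P PG; have [L E1 M] := fdb_eval_morph P.
  transitivity (fdb_eval2 (linv P) P (fdb_Delta f)).
    move: (fdb_Delta f); apply: (linear_ext (V := K^o)) => [||[a b]].
    - exact: linear_comp (linear_comp L (@tens_mul_linear _ _))
                         (mapL _ _ _ _ _ _).
    - by have [] := fdb_eval2_morph (linv P) P.
    rewrite tens_mapU tens_mul_tens M fdb_antipodeP //.
    by rewrite -tensUU fdb_eval2_tens.
  rewrite fdb_DeltaP //; last exact: linv_G1.
  rewrite (eq_fdb_eval f (linv_compr PG)) -counit_eval.
  by rewrite (linear_mapZ _ _ L) E1 [RHS]mulr1.
- move=> f _; apply: fdb_eval_inj => P PG; have [L E1 M] := fdb_eval_morph P.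
  transitivity (fdb_eval2 P (linv P) (fdb_Delta f)).
    move: (fdb_Delta f); apply: (linear_ext (V := K^o)) => [||[a b]].
    - exact: linear_comp (linear_comp L (@tens_mul_linear _ _))
                         (mapL _ _ _ _ _ _).
    - by have [] := fdb_eval2_morph P (linv P).
    rewrite tens_mapU tens_mul_tens M fdb_antipodeP //.
    by rewrite -tensUU fdb_eval2_tens.
  rewrite fdb_DeltaP //; last exact: linv_G1.
  rewrite (eq_fdb_eval f (linv_compl PG)) -counit_eval.
  by rewrite (linear_mapZ _ _ L) E1 [RHS]mulr1.
Qed.
End FaaDiBruno.

(** * Cutting a corolla along some of its chords *)

Lemma card_star n (A : {set 'I_n.+1}) :
  #|[set c : chord n | (c.1 == ord0) && (c.2 \in A)]| = #|A|.
Proof.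
have inj : injective (fun i => (ord0, i) : chord n) by move=> i j [].
rewrite -[RHS](card_imset _ inj); apply: eq_card => -[a b]; rewrite inE /=.
apply/andP/imsetP => [[/eqP -> bA]|[i iA [-> ->]]] //.
by exists b.
Qed.

Lemma card_corolla_chords n : #|corolla_chords n| = n.
Proof.
transitivity #|[set~ ord0 : 'I_n.+1]|; last by rewrite cardsC1 card_ord.
by rewrite -card_star; apply: eq_card => c; rewrite !inE.
Qed.

Lemma adjacent_corolla n (u v : 'I_n.+1) :
  adjacent (corolla_chords n) u v = (u == ord0) (+) (v == ord0).
Proof. by rewrite /adjacent !inE /=; case: eqP; case: eqP. Qed.

(** A cycle of length at least 3 is impossible: two consecutive vertices
    always include 0, which occurs only once. *)
Lemma corolla_dissection n : dissection (corolla_chords n).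
Proof.
apply/and4P; split.
- by rewrite card_corolla_chords.
- apply/forall_inP => -[a b]; rewrite !inE /= => /andP[/eqP -> b0].
  by rewrite lt0n.
- apply/forall_inP => c; rewrite !inE => /andP[/eqP c0 _].
  apply/forall_inP => d; rewrite !inE => /andP[/eqP d0 _].
  by rewrite /crossing c0 d0.
apply/forallP => k; apply/forallP => -[[|a [|b [|c t]]] /= sz];
  rewrite -(eqP sz) //.
rewrite /= !adjacent_corolla !inE !negb_or.
apply/negP => /and4P[/and3P[/and3P[nab nac nat'] /andP[nbc nbt] ut] ab bc].
have b0 : b = ord0.
(* otherwise the two neighbours of b, which are distinct, would both be 0 *)
  move: ab bc nac; case: (b =P ord0) => // _.
  by rewrite !addbF => /eqP -> /eqP ->; rewrite eqxx.
move: nac nab nbc nbt bc; rewrite b0 => nac nab; rewrite eq_sym => /negPf nc0.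
case: t => [|d t] in sz nat' ut *.
  by rewrite /= adjacent_corolla nc0 (negPf nab).
by rewrite /= inE eq_sym adjacent_corolla nc0 => /norP[/negPf -> _].
Qed.

(** Contracting on a set S of sides sends the vertex v of S to the number of
    sides of S before v.  On S this is a bijection with {0, ..., |S| - 1}, the
    minimum s0 going to 0; so a fan of chords from 0 to the other elements of
    S becomes a full corolla.  This covers both a face of a corolla cut along
    some chords, and the diagram of the cutting chords themselves. *)
Section ContractCorolla.
Variables (n : nat) (S : {set 'I_n.+1}) (s0 : 'I_n.+1).
Hypothesis s0S : s0 \in S.
Hypothesis s0_min : forall s, s \in S -> (s0 <= s)%N.

Lemma contract_vertex0 : contract_vertex S ord0 = ord0.
Proof.
apply/val_inj; rewrite /contract_vertex (_ : #|[set _ in S | _]| = 0%N).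
  by rewrite mod0n /= inordK.
by apply: eq_card0 => s; rewrite inE ltn0 andbF.
Qed.

Lemma contract_vertexE v : v \in S ->
  contract_vertex S v = #|[set s in S | (s < v)%N]| :> nat.
Proof.
move=> vS; have lt : (#|[set s in S | (s < v)%N]| < #|S|)%N.
  apply/proper_card/properP; split.
    by apply/subsetP => s; rewrite inE => /andP[].
  by exists v; rewrite // inE ltnn andbF.
by rewrite /contract_vertex modn_small // inordK //; lia.
Qed.

Lemma contract_vertex_neq0 v : v \in S :\ s0 -> contract_vertex S v != ord0.
Proof.
rewrite !inE => /andP[v0 vS]; rewrite -val_eqE /= contract_vertexE // -lt0n.
apply/card_gt0P; exists s0; rewrite inE s0S /= ltn_neqAle s0_min //.
by rewrite eq_sym val_eqE v0.
Qed.

Lemma contract_vertex_inj : {in S &, injective (contract_vertex S)}.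
Proof.
have mono u v : u \in S -> v \in S -> (u < v)%N ->
    (contract_vertex S u < contract_vertex S v)%N.
  move=> uS vS uv; rewrite !contract_vertexE //.
  apply/proper_card/properP; split.
    by apply/subsetP => s; rewrite !inE => /andP[-> su]; apply: ltn_trans uv.
  by exists u; rewrite !inE uS ?ltnn ?uv.
move=> u v uS vS uv; apply/val_inj; case: (ltngtP u v) => // lt.
  by have := mono _ _ uS vS lt; rewrite uv ltnn.
by have := mono _ _ vS uS lt; rewrite uv ltnn.
Qed.

Lemma contract_corolla :
  contract_chord S @: [set c | (c.1 == ord0) && (c.2 \in S :\ s0)] =
  corolla_chords #|S|.-1.
Proof.
have cE (c : chord n) : c.1 = ord0 -> c.2 \in S :\ s0 ->
    contract_chord S c = (ord0, contract_vertex S c.2).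
  move=> c1 c2; rewrite /contract_chord c1 contract_vertex0 /mkchord.
  by rewrite lt0n (contract_vertex_neq0 c2).
apply/eqP; rewrite eqEcard card_corolla_chords; apply/andP; split.
  apply/subsetP => _ /imsetP[c + ->]; rewrite inE => /andP[/eqP c1 c2].
  by rewrite cE // !inE eqxx contract_vertex_neq0.
rewrite card_in_imset => [|c d]; last first.
  rewrite !inE => /andP[/eqP c1 c2] /andP[/eqP d1 d2].
  rewrite !cE ?inE //.
  case: c d c1 c2 d1 d2 => [_ c] [_ d] /= -> /andP[_ cS] -> /andP[_ dS].
  by case=> /contract_vertex_inj -> .
by rewrite card_star (cardsD1 s0 S) s0S.
Qed.
End ContractCorolla.

Section CorollaCuts.
Variables (n : nat) (C : {set chord n}).
Hypothesis C_corolla : C \subset corolla_chords n.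
Implicit Types s t j : 'I_n.+1.

Let cut (s : 'I_n.+1) : bool := (ord0, s) \in C.

Let cutP c : c \in C -> [/\ c.1 = ord0, c.2 != ord0 & cut c.2].
Proof.
move=> cC; have := subsetP C_corolla c cC; rewrite inE => /andP[/eqP c1 c2].
by split=> //; rewrite /cut -c1 -surjective_pairing.
Qed.

Lemma same_faceP s t :
  reflect (forall j, cut j -> (s < j)%N = (t < j)%N) (same_face C s t).
Proof.
apply: (iffP forall_inP) => [st j jC|st c /cutP[c1 _ /st]].
  by have /eqP := st _ jC.
by rewrite /side_below c1 => ->.
Qed.

Lemma same_face_equiv : equivalence_rel (same_face C).
Proof.
move=> r s t; split; first by apply/same_faceP.
by move/same_faceP=> rs; apply/same_faceP/same_faceP=> h j jC; rewrite -h // rs.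
Qed.

(** The sides s - 1 and s are separated exactly when the chord from 0 to s is
    a cut, so a face begins at 0 or at a cut. *)
Lemma in_minimal_sides s : (s \in minimal_sides C) = (s == ord0) || cut s.
Proof.
rewrite inE; apply/forall_inP/orP => [s_min|[/eqP -> //|sC] t /same_faceP].
  have [|s0] := eqVneq s ord0; [by left|right].
  have ps : (s.-1 < n.+1)%N by have := ltn_ord s; lia.
  apply: contraT => sC; suff /s_min : same_face C s (Ordinal ps).
    by move: s0; rewrite -val_eqE /=; lia.
  apply/same_faceP => j jC /=.
  have js : j != s :> nat by apply: contraNneq sC => /val_inj <-.
  by move: s0; rewrite -val_eqE /=; lia.
by move/(_ _ sC); rewrite ltnn; case: ltnP.
Qed.

Definition face_of s := [set t | same_face C s t].

Lemma faces_corolla : faces C = face_of @: minimal_sides C.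
Proof.
apply/setP => S; apply/imsetP/imsetP => -[s _ ->]; last first.
  by exists s; rewrite ?inE //; apply/setP => t; rewrite !inE.
have ss : same_face C s s by apply/same_faceP.
case: (arg_minnP (P := same_face C s) (fun t => val t) ss) => m sm m_min.
have ms t : same_face C m t = same_face C s t.
  by rewrite (same_face_equiv s m t).2.
exists m; last by apply/setP => t; rewrite !inE /= ms.
by rewrite inE; apply/forall_inP => t; rewrite ms => /m_min.
Qed.

Lemma face_of_inj : {in minimal_sides C &, injective face_of}.
Proof.
have le s t : s \in minimal_sides C -> face_of s = face_of t -> (s <= t)%N.
  rewrite inE => /forall_inP smin st; apply: smin.
  have : t \in face_of t by rewrite inE; apply/same_faceP.
  by rewrite -st inE.
move=> s t sm tm st; apply/val_inj/eqP.
by rewrite eqn_leq (le s t) // (le t s).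
Qed.

(** A chord from 0 to d lies in the face beginning at s exactly when d belongs
    to that face and differs from s: for d = s it is either a cut or not a
    chord at all. *)
Lemma face_diagram_corolla s : s \in minimal_sides C ->
  face_diagram (corolla_chords n) C (face_of s) =
  corolla_chords #|face_of s|.-1.
Proof.
move=> sm; have ss : s \in face_of s by rewrite inE; apply/same_faceP.
have smin t : t \in face_of s -> (s <= t)%N.
  by move: sm; rewrite !inE => /forall_inP; apply.
rewrite -(contract_corolla ss smin) /face_diagram.
suff -> : [set d in corolla_chords n :\: C | lies_in C d (face_of s)] =
    [set c : chord n | (c.1 == ord0) && (c.2 \in face_of s :\ s)] by [].
have neq d j : ~~ cut d -> cut j -> j != d :> nat.
  by move=> dC; apply: contraTneq => /val_inj ->.
apply/setP => -[a d]; rewrite !inE /=.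
case: eqP => [->|] /=; last by rewrite andbF.
apply/andP/andP => [[/andP[dC d0] /forall_inP dl]|[ds /same_faceP sd]].
  split.
    apply: contraNneq dC => dE; move: sm.
    by rewrite in_minimal_sides -dE (negPf d0).
  apply/same_faceP => j jC; have /forall_inP/(_ _ ss)/eqP := dl _ jC.
  rewrite /chord_below /side_below /= => <-.
  by rewrite [in RHS]ltn_neqAle eq_sym neq.
have lt_sd : (s < d)%N.
  by rewrite ltn_neqAle eq_sym ds smin // inE; apply/same_faceP.
have dC : ~~ cut d by apply/negP => /sd; rewrite lt_sd ltnn.
rewrite -/(cut d) dC -(inj_eq val_inj) /= -lt0n (leq_ltn_trans _ lt_sd) //.
split=> //; apply/forall_inP => c /cutP[c1 _ cC].
apply/forall_inP => t; rewrite inE => /same_faceP st.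
rewrite /chord_below /side_below /= c1 /= -st // sd // [(d <= _)%N]leq_eqVlt.
by rewrite [val d == _]eq_sym (negPf (neq _ _ dC cC)).
Qed.

(** Apart from 0, the minimal sides are the end points of the cuts. *)
Lemma r_diagram_corolla : r_diagram C = corolla_chords #|minimal_sides C|.-1.
Proof.
have m0 : ord0 \in minimal_sides C by rewrite in_minimal_sides eqxx.
rewrite -(contract_corolla m0) // /r_diagram.
suff <- : C = [set c : chord n |
    (c.1 == ord0) && (c.2 \in minimal_sides C :\ ord0)] by [].
apply/setP => c; rewrite in_set in_setD1 in_minimal_sides; apply/idP/idP.
  by case/cutP => -> -> ->; rewrite eqxx orbT.
by case: c => a b /= /andP[/eqP -> /andP[/negPf ->]].
Qed.

Lemma card_minimal_sides : #|minimal_sides C| = #|C|.+1.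
Proof.
rewrite (cardsD1 ord0) in_minimal_sides eqxx add1n; congr _.+1.
rewrite -card_star; apply: eq_card => c.
rewrite in_set in_setD1 in_minimal_sides.
apply/idP/idP; last by case/cutP => -> -> ->; rewrite eqxx orbT.
by case: c => a b /= /andP[/eqP -> /andP[/negPf ->]].
Qed.
End CorollaCuts.

(** Without its only chord, v is isolated, hence cut off from the root. *)
Lemma oriented_corolla n (v : 'I_n.+1) : v != ord0 ->
  oriented (corolla_chords n) ord0 v = false.
Proof.
move=> v0; apply/negP => /connectP[[|u p] /=].
  by move=> _ /eqP; rewrite eq_sym (negPf v0).
rewrite /adjacent /mkchord lt0n v0 !inE /= !xpair_eqE (negPf v0) /=.
by case: eqP => [->|//]; rewrite eqxx.
Qed.

Lemma k_number_corolla n (C : {set chord n}) : C \subset corolla_chords n ->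
  k_number (corolla_chords n) C = 0%N.
Proof.
move=> sub; apply: eq_card0 => c; rewrite !inE; apply: negbTE.
rewrite negb_and negbK.
case: (boolP (c \in C)) => //= cC.
have := subsetP sub c cC; rewrite inE => /andP[/eqP c1 c2].
have m0 : ord0 \in minimal_sides C by rewrite in_minimal_sides ?eqxx.
rewrite r_diagram_corolla // c1 oriented_corolla //.
rewrite contract_vertex0 oriented_corolla //.
apply: (contract_vertex_neq0 (s0 := ord0)) => //.
by rewrite in_setD1 c2 in_minimal_sides // -c1 -surjective_pairing cC orbT.
Qed.

(** * Summing over all sets of cuts *)

Section FaceProducts.
Variables (R : comNzRingType) (u : nat -> R).

(** In a word of bits, a bit 1 at s marks s as the first side of a face, which
    extends up to the next bit 1 or to the end of the word; so its size is one
    more than the length of the run of bits 0 directly after s. *)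
Fixpoint face_prod (w : bitseq) : R :=
  if w is b :: w' then (if b then u (find id w').+1 else 1) * face_prod w'
  else 1.

Lemma face_prodE w :
  \prod_(s < size w | nth false w s) u (find id (drop s.+1 w)).+1 = face_prod w.
Proof.
elim: w => [|b w IHw] /=; first by rewrite big_ord0.
by rewrite big_mkcond big_ord_recl /= drop0 -big_mkcond /= IHw.
Qed.

Lemma sum_tupleS (T : finType) (V : nmodType) n (P : pred (seq T))
    (F : seq T -> V) :
  \sum_(w : n.+1.-tuple T | P w) F w =
  \sum_(b : T) \sum_(w : n.-tuple T | P (b :: w)) F (b :: w).
Proof.
rewrite pair_big_dep /=.
rewrite (reindex (fun p : T * n.-tuple T => [tuple of p.1 :: p.2])) //=.
exists (fun w : n.+1.-tuple T => (thead w, [tuple of behead w]))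
  => [[b w] _|w _] /=.
  by congr pair; apply/val_inj.
by rewrite -tuple_eta.
Qed.

Hypothesis u0 : u 0%N = 0.

Lemma cpowS k n :
  cpow u k.+1 n.+1 = \sum_(j < n.+1) u j.+1 * cpow u k (n - j)%N.
Proof. by rewrite /= big_ord_recl u0 mul0r add0r. Qed.

(** The factor u (a + find id w) is that of a face which has already a sides
    when w begins.  In the induction, a first bit 1 closes this face, which
    accounts for the term j = 0 of the right-hand side, and a first bit 0
    enlarges it, which accounts for the others. *)
Lemma sum_face_prod n k a :
  \sum_(w : n.-tuple bool | count id w == k) u (a + find id w)%N * face_prod w =
  \sum_(j < n.+1) u (a + j)%N * cpow u k (n - j)%N.
Proof.
elim: n k a => [|n IHn] k a.
  rewrite big_ord1; case: k => [|k] /=.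
    by rewrite (big_pred1 [tuple]) // => w; rewrite tuple0.
  by rewrite big_ord1 u0 mul0r mulr0 big_pred0 // => w; rewrite tuple0.
rewrite (sum_tupleS n (fun w : bitseq => count id w == k)
          (fun w : bitseq => u (a + find id w)%N * face_prod w)) big_bool.
rewrite big_ord_recl; congr (_ + _).
  rewrite /= addn0; under eq_bigr do rewrite mulrA [u a * _]mulrC -mulrA.
  case: k => [|k]; first by rewrite big_pred0 ?mulr0.
  rewrite subn0 cpowS -(IHn k 1%N) mulr_sumr.
  by apply: eq_bigr => w _; rewrite add1n mulrCA.
transitivity (\sum_(j < n.+1) u (a.+1 + j)%N * cpow u k (n - j)%N).
  by rewrite -IHn; apply: eq_bigr => w _; rewrite /= mul1r addSnnS.
by apply: eq_bigr => j _; rewrite /= addSnnS subSS.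
Qed.

Lemma sum_face_prod_true n k :
  \sum_(w : n.-tuple bool | count id w == k) face_prod (true :: w) =
  cpow u k.+1 n.+1.
Proof. by rewrite cpowS -(sum_face_prod n k 1). Qed.
End FaceProducts.

Section Cuts.
Variables (n : nat).
Implicit Type w : n.-tuple bool.

(** The bit of index i of w tells whether the chord from 0 to i + 1 is a cut,
    whence the shift by one leading bit: side 0 is no cut, although a face
    begins there. *)
Definition cuts w : {set chord n} :=
  [set c : chord n | (c.1 == ord0) && nth false (false :: w) c.2].

Lemma cuts_corolla w : cuts w \subset corolla_chords n.
Proof.
apply/subsetP => c; rewrite !inE => /andP[-> ]; apply: contraL => /eqP -> //.
Qed.

Lemma sum_corolla_subsets (V : nmodType) (F : {set chord n} -> V) :
  \sum_(C : {set chord n} | C \subset corolla_chords n) F C = \sum_w F (cuts w).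
Proof.
rewrite (reindex cuts) /=; first by apply: eq_bigl => w; rewrite cuts_corolla.
exists (fun C : {set chord n} => [tuple (ord0, lift ord0 i) \in C | i < n])
  => [w _|C /subsetP sub].
  apply: eq_from_tnth => i; rewrite tnth_mktuple inE eqxx /=.
  by rewrite (tnth_nth false).
apply/setP => -[a b]; rewrite inE /=; apply/andP/idP => [[/eqP ->]|abC].
  case: (unliftP ord0 b) => [i ->|-> //].
  by rewrite lift0 [nth _ _ _]nth_mktuple.
have := sub _ abC; rewrite inE /= => /andP[/eqP a0]; split; first by rewrite a0.
move: abC; rewrite a0; case: (unliftP ord0 b) => [i -> abC|bE]; last first.
  by rewrite bE eqxx in b0 *.
by rewrite lift0 [nth _ _ _]nth_mktuple.
Qed.

Lemma card_cuts w : #|cuts w| = count id w.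
Proof.
transitivity #|[set i : 'I_n.+1 | nth false (false :: w) i]|.
  by rewrite -card_star; apply: eq_card => c; rewrite !inE.
rewrite -sum1_card -sum1_count big_mkcond big_ord_recl inE /= add0n.
rewrite [RHS]big_mkcond (big_nth false) big_mkord size_tuple.
by apply: eq_bigr => i _; rewrite inE.
Qed.

Lemma in_minimal_cuts w (s : 'I_n.+1) :
  (s \in minimal_sides (cuts w)) = nth false (true :: w) s.
Proof.
rewrite in_minimal_sides ?cuts_corolla // inE eqxx /=.
by case: s => -[|s].
Qed.

(** The face beginning at s runs from s to the side before the next cut. *)
Lemma card_face_cuts w (s : 'I_n.+1) : s \in minimal_sides (cuts w) ->
  #|face_of (cuts w) s| = (find id (drop s w)).+1.
Proof.
rewrite in_minimal_cuts => sm; set f := find id _.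
have fn : (s + f <= n)%N.
  have := find_size id (drop s w); rewrite -/f size_drop size_tuple.
  by have := ltn_ord s; lia.
have cutE (j : 'I_n.+1) : ((ord0, j) \in cuts w) = nth false (false :: w) j.
  by rewrite inE eqxx.
have -> : face_of (cuts w) s = [set inord (s + i) | i : 'I_f.+1].
  apply/setP => t; rewrite inE; apply/(same_faceP (cuts_corolla w))/imsetP.
    move=> st; suff /andP[le_st le_t] : (s <= t <= s + f)%N.
      have lt : (t - s < f.+1)%N by lia.
      exists (Ordinal lt) => //; apply/val_inj.
      by rewrite /= inordK ?subnKC //; have := ltn_ord t; lia.
    apply/andP; split; rewrite leqNgt; apply/negP => lt.
      have cut_s : nth false (false :: w) s by case: (s : nat) sm lt.
      by have := st s; rewrite cutE ltnn lt => /(_ cut_s).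
    have jn : ((s + f).+1 < n.+1)%N by have := ltn_ord t; lia.
    have cut_j : nth false (false :: w) (s + f).+1.
      rewrite /= -nth_drop (nth_find false (a := id)) // has_find.
      by rewrite size_drop size_tuple -/f; lia.
    have := st (Ordinal jn); rewrite cutE /= => /(_ cut_j).
    by rewrite ltnS leq_addr ltnS leqNgt lt.
  case=> i _ -> j; rewrite cutE inordK; last by have := ltn_ord i; lia.
  case: (ltnP s j) => [lt_sj cut_j|]; last by lia.
  apply/esym; rewrite ltnNge; apply/negP => le_ji.
  have fm : (j - s.+1 < f)%N by have := ltn_ord i; lia.
  have := before_find false fm; rewrite nth_drop.
  by move: cut_j; rewrite -{1}(subnKC lt_sj) addSn /= => ->.
rewrite card_imset ?card_ord // => i j /(congr1 val) /=.
rewrite !inordK => [/addnI /val_inj //||]; first by have := ltn_ord j; lia.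
by have := ltn_ord i; lia.
Qed.
End Cuts.

(** * The isomorphism *)

Section CorollaCoproduct.
Variables (K : fieldType) (x : K).

(** The image of the universal series under Sigma_n |-> X_n. *)
Definition corolla_series (n : nat) : HD K :=
  if n is n'.+1 then corolla K n' else 0.

Lemma q_elt_corolla n (w : n.-tuple bool) :
  q_elt K (corolla_chords n) (cuts w) = face_prod corolla_series (true :: w).
Proof.
have sub := cuts_corolla w.
rewrite -face_prodE /= size_tuple /q_elt (faces_corolla sub).
rewrite big_imset /=; last exact: face_of_inj.
apply: eq_big => [s|s sm]; first exact: in_minimal_cuts.
by rewrite face_diagram_corolla // card_face_cuts.
Qed.

Lemma r_elt_corolla n (w : n.-tuple bool) :
  r_elt K (cuts w) = corolla K (count id w).
Proof.
have sub := cuts_corolla w.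
by rewrite /r_elt r_diagram_corolla // card_minimal_sides // card_cuts.
Qed.

(** Grouping the sets of cuts by their number k of elements, which is the
    degree of the right factor; the term of index 0 of the right-hand side
    vanishes, and that of index k + 1 is the one of the sets of k cuts. *)
Lemma comul_corolla n : comul_diagram x (corolla_chords n) =
  \sum_(k < n.+2) cpow corolla_series k n.+1 \ox corolla_series k.
Proof.
transitivity (\sum_(w : n.-tuple bool)
    face_prod corolla_series (true :: w) \ox corolla K (count id w)).
  rewrite /comul_diagram sum_corolla_subsets; apply: eq_bigr => w _.
  rewrite k_number_corolla ?cuts_corolla // scale1r.
  by rewrite q_elt_corolla r_elt_corolla.
rewrite big_ord_recl (linear_map0 (tens_linearr _)) add0r.
have count_lt (w : n.-tuple bool) : (count id w < n.+1)%N.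
  by rewrite ltnS -[X in (_ <= X)%N](size_tuple w) count_size.
rewrite (partition_big (fun w => Ordinal (count_lt w)) predT) //.
apply: eq_bigr => k _; rewrite lift0 -sum_face_prod_true //.
rewrite (linear_map_sum _ _ _ (tens_linearl (corolla K k))).
by apply: eq_big => [w|w /eqP <-].
Qed.

Definition corolla_diagram (i : nat) : pos_diagram :=
  existT (fun n => diagram n.+1) i
    (exist (fun D => dissection D) _ (corolla_dissection i.+1)).

Lemma corollaS i : corolla K i.+1 = << ucm (corolla_diagram i) >>.
Proof.
rewrite /corolla /diag_elt; case: insubP => [D _ DE|]; last first.
  by rewrite corolla_dissection.
suff -> : D = tagged (corolla_diagram i) by [].
exact: val_inj.
Qed.

Definition to_corollas : HFdB K -> HD K := poly_ext (fun i => corolla K i.+1).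

(** A retraction of [to_corollas]: it kills the generators that are not
    corollas. *)
Definition of_corollas : HD K -> HFdB K :=
  poly_ext (fun d =>
    if d == corolla_diagram (tag d) then << ucm (tag d) >> else 0).

Lemma to_corollas_morph : alg_morph to_corollas.
Proof. exact: poly_ext_morph. Qed.

Lemma of_corollas_morph : alg_morph of_corollas.
Proof. exact: poly_ext_morph. Qed.

Lemma to_corollas_Sigma n : to_corollas (Sigma K n) = corolla_series n.
Proof.
have [phiL phi1 _] := to_corollas_morph.
by case: n => [|[|n]]; [exact: linear_map0 | exact: phi1 | exact: poly_extU].
Qed.

Lemma to_corollasK : cancel to_corollas of_corollas.
Proof.
have id_morph : alg_morph (@id (HFdB K)) by [].
have comp_morph := alg_morph_comp of_corollas_morph to_corollas_morph.
apply: (alg_morph_ext comp_morph id_morph) => i.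
by rewrite [to_corollas _]poly_extU corollaS [of_corollas _]poly_extU /= eqxx.
Qed.

Lemma comul_to_corollas q :
  comulD x (to_corollas q) = tens_map to_corollas to_corollas (fdb_Delta q).
Proof.
have [phiL phi1 phiM] := to_corollas_morph.
move: q; apply: alg_morph_ext => [||i].
- exact: alg_morph_comp (poly_ext_morph _) to_corollas_morph.
- exact: alg_morph_comp (tens_map_morph to_corollas_morph to_corollas_morph)
                        (fdb_Delta_morph K).
rewrite [to_corollas _]poly_extU corollaS [comulD _ _]poly_extU /=.
rewrite comul_corolla.
rewrite [fdb_Delta _]poly_extU.
rewrite (linear_map_sum _ _ _ (tens_map_linear to_corollas to_corollas)).
apply: eq_bigr => k _; rewrite (tens_map_tens _ _ phiL phiL) to_corollas_Sigma.
congr (_ \ox _); rewrite (morph_cpow (linear_map0 phiL) phi1 _ phiM) => [|p q].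
  by apply/esym/eq_cpow/to_corollas_Sigma.
exact: linear_mapB phiL.
Qed.

Lemma counit_to_corollas q : counit (to_corollas q) = counit q.
Proof.
move: q; apply: (alg_morph_ext (A := K^o : comAlgType K)) => [||i].
- exact: (alg_morph_comp (C := K^o : comAlgType K)
                         (counit_morph K _) to_corollas_morph).
- exact: counit_morph.
by rewrite [to_corollas _]poly_extU corollaS /counit !mcoeffU1 !cm1_eq1.
Qed.

(** Products of corollas are the images of monomials; a factor X_0 = 1 is the
    image of the leading coefficient 1 of the universal series. *)
Lemma CX_to_corollas p : CX p <-> exists q, p = to_corollas q.
Proof.
have [phiL phi1 phiM] := to_corollas_morph.
split=> [[s ->]|[q ->]].
  exists (\sum_(u <- s) u.1 *: \prod_(n <- u.2) Sigma K n.+1).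
  rewrite (linear_map_sum _ _ _ phiL); apply: eq_bigr => u _.
  rewrite (linear_mapZ _ _ phiL); congr (_ *: _).
  rewrite (big_morph to_corollas phiM phi1).
  by apply: eq_bigr => n _; rewrite to_corollas_Sigma.
exists [seq (q@_m, flatten [seq nseq (m i) i.+1 | i <- finsupp m])
       | m <- msupp q].
rewrite big_map; apply: eq_bigr => m _ /=; congr (_ *: _).
rewrite big_flatten big_map; apply: eq_bigr => i _.
by rewrite big_nseq iter_mulr_1.
Qed.
End CorollaCoproduct.

Theorem proposition5 (K : fieldType) (charK : [pchar K]%R =i pred0) (x : K) :
  exists DeltaF : HFdB K -> HFdB2 K,
    [/\ fdb_comul DeltaF,
        forall Delta, fdb_comul Delta -> Delta =1 DeltaF
      & exists (SX : HD K -> HD K) (SF : HFdB K -> HFdB K)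
               (phi : HFdB K -> HD K),
          [/\ hopf_subalgebra (@CX K) (comulD x) (@counit K _) SX,
              hopf_subalgebra (@full (HFdB K)) DeltaF (@counit K _) SF
            & hopf_iso DeltaF (@counit K _) SF
                (@CX K) (comulD x) (@counit K _) SX phi]].
Proof.
exists (@fdb_Delta K); split.
- exact: fdb_DeltaP.
- by move=> Delta; apply: fdb_Delta_unique.
have [phiL phi1 phiM] := to_corollas_morph K.
have [psiL _ _] := of_corollas_morph K.
have [SL _ _] : alg_morph (@fdb_antipode K) by apply: poly_ext_morph.
(* the antipode is prescribed on the image only; the retraction extends it *)
pose SX p := to_corollas (fdb_antipode (of_corollas (K := K) p)).
have S_phi q : SX (to_corollas q) = to_corollas (fdb_antipode q).
  by rewrite /SX to_corollasK.
have FH := fdb_hopf charK.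
exists SX, (@fdb_antipode K), (@to_corollas K); split.
- apply: (hopf_transport (to_corollas_morph K) _ _ _ _ _ _ S_phi FH).
  + exact: poly_ext_morph.
  + exact: counit_morph.
  + exact: linear_comp phiL (linear_comp SL psiL).
  + exact: CX_to_corollas.
  + exact: comul_to_corollas.
  + exact: counit_to_corollas.
- exact: FH.
split.
- exact: phiL.
- exact: phi1.
- exact: phiM.
- exact: can_inj (@to_corollasK K).
- exact: CX_to_corollas.
- exact: comul_to_corollas.
- exact: counit_to_corollas.
- exact: S_phi.
Qed.
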